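(* Let $\mathcal{G}$ be a matrix product system satisfying the irreducibility hypothesis. (i) If $\gamma\in\Sigma$ is any path, then $\underline{\lambda}(\gamma),\overline{\lambda}(\gamma)\in[\alpha_{\min},\alpha_{\max}]$. (ii) For any $\alpha\in[\alpha_{\min},\alpha_{\max}]$ and any $\xi\in\Sigma^*$ with $T(\xi)$ non-zero, there exist some $\gamma=(e_m)_{m=1}^\infty\in\Sigma$ and a sequence $(m_j)_{j=1}^\infty$ of positive integers such that $\lambda(\gamma)=\alpha$, $\lim_{j\to\infty}m_{j+1}/m_j=1$, and for each $j\in\mathbb{N}$, $\xi$ is a prefix of $(e_{m_j},e_{m_j+1},\ldots)$.
   Context: A (graph-directed) matrix product system $\mathcal{G}$ consists of a finite strongly connected directed graph $G$ (loops and parallel edges allowed) with vertex set $V(G)$ and edge set $E(G)$; a dimension $d(v)\in\mathbb{N}=\{1,2,\ldots\}$ for each vertex $v$; and, for each edge $e$ from $v_1$ to $v_2$, a $d(v_1)\times d(v_2)$ matrix $T(e)$ with non-negative real entries and a weight $W(e)\in(0,1)$. $\Sigma$ is the set of all infinite paths $(e_i)_{i=1}^\infty$ in $G$ and $\Sigma^*$ is the set of all finite paths in $G$. For $\eta=(e_1,\ldots,e_n)\in\Sigma^*$ with $n\ge1$ put $T(\eta)=T(e_1)\cdots T(e_n)$, $W(\eta)=W(e_1)\cdots W(e_n)$ and $\eta^-=(e_1,\ldots,e_{n-1})$; the empty path has $W=1$. A path $\eta\in\Sigma^*$ is a prefix of a (finite or infinite) path $\gamma$ if $\gamma=\eta\gamma'$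 for some path $\gamma'$; $\gamma|n$ is the prefix of length $n$ of $\gamma\in\Sigma$. For a non-negative matrix $M$, $\|M\|=\sum_{i,j}M_{i,j}$. $\mathcal{G}$ satisfies the irreducibility hypothesis (is irreducible) if there is a finite family $\mathcal{H}\subset\Sigma^*$ of paths (each with at least one edge) such that for any vertices $v_1,v_2$ and any $1\le i\le d(v_1)$, $1\le j\le d(v_2)$, there is a path $\gamma\in\mathcal{H}$ from $v_1$ to $v_2$ with $T(\gamma)_{i,j}>0$. For $t>0$, $\Sigma_t=\{\eta\in\Sigma^*: W(\eta)<t\le W(\eta^-),\ \|T(\eta)\|>0\}$. Define $$\alpha_{\min}=\lim_{t\to0}\min_{\eta\in\Sigma_t}\frac{\log\|T(\eta)\|}{\log t},\qquad \alpha_{\max}=\lim_{t\to0}\max_{\eta\in\Sigma_t}\frac{\log\|T(\eta)\|}{\log t};$$ for irreducible $\mathcal{G}$ these limits exist and are real. For $\gamma\in\Sigma$, the lower and upper Lyapunov exponents $\underline{\lambda}(\gamma)$, $\overline{\lambda}(\gamma)$ are the $\liminf$ and $\limsup$ as $n\to\infty$ of $\frac{\log\|T(\gamma|n)\|}{\log W(\gamma|n)}$; when these values coincide, the common value is the Lyapunov exponent $\lambda(\gamma)$.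
   Formalization: In (i), ''any path'' is restricted to paths γ with T(γ|n) non-zero for every n; otherwise log‖T(γ|n)‖ is undefined (or −∞, and the claim fails, e.g. for loops carrying the four 2×2 matrix units). *)

(* Defs.v *)
From HB Require Import structures.
From mathcomp Require Import all_boot all_order all_algebra.
From mathcomp Require Import all_classical all_reals all_analysis.
Import Order.TTheory GRing.Theory Num.Theory.
Import numFieldNormedType.Exports.

Set Implicit Arguments.
Unset Strict Implicit.
Unset Printing Implicit Defensive.

Local Open Scope classical_set_scope.
Local Open Scope ring_scope.

(* Loops and parallel edges are allowed: [arc u v] is the finite type of edges
   from [u] to [v]. *)
Record digraph := Digraph {
  vertex :> finType;
  arc : vertex -> vertex -> finType }.
Arguments arc {_} _ _.

(* Paths grow at the end, so that in [psnoc p e] the path [p] is the parent. *)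
Inductive gpath (G : digraph) (u : G) : G -> Type :=
| pnil : gpath u u
| psnoc v w of gpath u v & arc v w : gpath u w.
Arguments pnil {G u}.
Arguments psnoc {G u v w} _ _.

Definition strongly_connected (G : digraph) : Prop :=
  forall u v : G, inhabited (gpath u v).

Record mps (R : realType) := MPS {
  graph :> digraph;
  graph_connected : strongly_connected graph;
  dimv : graph -> nat;
  dimv_gt0 : forall v, (0 < dimv v)%N;
  Tarc : forall u v : graph, arc u v -> 'M[R]_(dimv u, dimv v);
  Tarc_ge0 : forall (u v : graph) (e : arc u v) i j, 0 <= Tarc e i j;
  Warc : forall u v : graph, arc u v -> R;
  Warc_gt0 : forall (u v : graph) (e : arc u v), 0 < Warc e;
  Warc_lt1 : forall (u v : graph) (e : arc u v), Warc e < 1 }.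
Arguments dimv {R _} _.
Arguments Tarc {R _ u v} _.
Arguments Warc {R _ u v} _.

Section Paths.
Variable G : digraph.

Record finpath := FinPath { fsrc : G; fdst : G; walk :> gpath fsrc fdst }.

Definition edge := {uv : G * G & arc uv.1 uv.2}.

Definition mk_edge (u v : G) (e : arc u v) : edge :=
  @existT (G * G) (fun uv => arc uv.1 uv.2) (u, v) e.

Fixpoint edges (u v : G) (p : gpath u v) : seq edge :=
  if p is psnoc _ _ q e then rcons (edges q) (mk_edge e) else [::].

(* The empty path is its own parent; [Sigma_t] below never contains it, since
   there it would need 1 < t <= 1. *)
Definition parent (p : finpath) : finpath :=
  let: FinPath u _ q := p in
  if q is psnoc _ _ q' _ then FinPath q' else FinPath (@pnil G u).

(* [iarc 0] is the first edge. *)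
Record infpath := InfPath {
  ivtx : nat -> G;
  iarc : forall n, arc (ivtx n) (ivtx n.+1) }.

Fixpoint itake (g : infpath) (n : nat) : gpath (ivtx g 0) (ivtx g n) :=
  if n is k.+1 then psnoc (itake g k) (iarc g k) else pnil.

Definition ishift (m : nat) (g : infpath) : infpath :=
  @InfPath (fun k => ivtx g (k + m)%N) (fun k => iarc g (k + m)%N).

Definition iedge (g : infpath) (k : nat) : edge := mk_edge (iarc g k).

(* g = p g' as sequences of edges: the default value of [nth] supplies the
   edges of g' beyond the end of p. *)
Definition is_prefix (p : finpath) (g : infpath) : Prop :=
  exists g' : infpath, forall k,
    iedge g k = nth (iedge g' (k - size (edges p))) (edges p) k.

End Paths.

Section MatrixProducts.
Variables (R : realType) (G : mps R).

Fixpoint Tpath (u v : G) (p : gpath u v) : 'M[R]_(dimv u, dimv v) :=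
  if p is psnoc _ _ q e then Tpath q *m Tarc e else 1%:M.

Fixpoint Wpath (u v : G) (p : gpath u v) : R :=
  if p is psnoc _ _ q e then Wpath q * Warc e else 1.

Definition irreducible_mps : Prop :=
  exists H : set (finpath G),
    [/\ finite_set H,
        (forall p, H p -> (0 < size (edges p))%N) &
        forall (u v : G) (i : 'I_(dimv u)) (j : 'I_(dimv v)),
          exists p : gpath u v, H (FinPath p) /\ 0 < Tpath p i j].

Definition mxsum (m n : nat) (M : 'M[R]_(m, n)) : R := \sum_i \sum_j M i j.

Definition Sigma_t (t : R) : set (finpath G) :=
  [set p : finpath G | Wpath p < t <= Wpath (parent p) /\ 0 < mxsum (Tpath p)].

Definition log_ratio (t : R) (p : finpath G) : R := ln (mxsum (Tpath p)) / ln t.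

(* For irreducible G and 0 < t <= 1 the set [Sigma_t t] is finite and nonempty,
   so these infima and suprema are minima and maxima. *)
Definition alpha_min : R :=
  lim (inf [set log_ratio t p | p in Sigma_t t] @[t --> (0 : R)^'+]).

Definition alpha_max : R :=
  lim (sup [set log_ratio t p | p in Sigma_t t] @[t --> (0 : R)^'+]).

(* Extended-real valued, with log 0 = -oo; as log W < 0, the ratio is +oo once
   the matrix product vanishes. *)
Definition lyap_ratio (g : infpath G) (n : nat) : \bar R :=
  (lne (mxsum (Tpath (itake g n)))%:E / (ln (Wpath (itake g n)))%:E)%E.

Definition lower_lyap (g : infpath G) : \bar R := limn_einf (lyap_ratio g).

Definition upper_lyap (g : infpath G) : \bar R := limn_esup (lyap_ratio g).

Definition has_lyap (g : infpath G) (a : \bar R) : Prop :=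
  lower_lyap g = a /\ upper_lyap g = a.

End MatrixProducts.

Arguments alpha_min {R} G.
Arguments alpha_max {R} G.

(* Main.v *)
Require Import Defs.
From mathcomp Require Import all_boot all_order all_algebra.
From mathcomp Require Import all_classical all_reals all_analysis.
From mathcomp Require Import ring lra zify.
Set Implicit Arguments.
Unset Strict Implicit.
Unset Printing Implicit Defensive.
Import Order.TTheory GRing.Theory Num.Theory.
Import numFieldNormedType.Exports.
Local Open Scope classical_set_scope.
Local Open Scope ring_scope.

(** Write [wlen p = - ln W(p)] and [tlen p = - ln ||T(p)||], so that a Lyapunov
    exponent is a limit of [tlen / wlen] along a path. Under concatenation [wlen]
    is additive and [tlen] is superadditive, because the norm is submultiplicative.
    Irreducibility gives a partial converse ([splice]): any two paths with non-zero
    product can be joined by a connecting path of bounded length so that [tlen]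
    of the result exceeds the sum of the two by at most a constant. Moreover
    [tlen] is bounded by an affine function of [wlen] ([tlen_bound]), hence short
    pieces of path change [tlen] only by a bounded amount.

    The extremal exponents. For [t = exp (- s)], the paths in [Sigma_t t] are those
    whose [wlen] has just passed [s]. Both the minimum and the maximum of [tlen] over
    them are superadditive in [s], up to a constant and a bounded delay in the
    argument: the minimum because a path of length [s + r] can be cut into paths of
    lengths [s] and [r], the maximum because two paths can be spliced. A form of
    Fekete's lemma ([shifted_fekete]) then yields the limits that define [alpha_min]
    and [alpha_max]. The first half of the theorem follows, since every non-empty
    initial segment of an infinite path belongs to some [Sigma_t].

    Paths with a prescribed exponent [a]. The path is the limit of a sequence of
    finite paths, each obtained from the preceding one by splicing on a block of
    length about [k + 1] at step [k], then [xi] ([append_block]). The block is chosen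
    greedily ([greedy_step]): with [tlen] almost minimal when [tlen - a * wlen] is
    positive so far, almost maximal otherwise. As [a] lies between the extremal
    exponents, [tlen - a * wlen] is pushed towards zero at every step, up to errors
    that are small compared with the block, and so stays negligible compared
    with [wlen] ([restoring_drift]). The length after [k] steps grows quadratically
    in [k] while the blocks grow linearly; hence the behaviour inside the blocks
    does not affect the exponent ([exponent_from_blocks]), and the gaps between
    successive occurrences of [xi] are negligible compared with their positions. *)

(** * Finite and linear bounds; superadditivity with a delay *)

Lemma eventually_le_linear (R : realType) (M eps : R) : 0 < eps ->
  exists2 s0, 0 < s0 & forall s, s0 <= s -> M <= eps * s.
Proof.
move=> eps0; exists (`|M| / eps + 1) => [|s]; first by rewrite ltr_wpDl ?divr_ge0 // ltW.
move=> hs; apply: (le_trans (ler_norm M)).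
rewrite mulrC -ler_pdivrMr //; apply: le_trans hs; lra.
Qed.

Lemma finite_bound (R : realType) (T : finType) (f : T -> R) :
  exists2 M, 0 < M & forall x, f x <= M.
Proof.
exists (1 + \sum_x `|f x|) => [|x].
  by rewrite ltr_pwDl // sumr_ge0.
apply: (le_trans (ler_norm _)); rewrite (bigD1 x) //= addrCA lerDl.
by rewrite addr_ge0 // sumr_ge0.
Qed.

Lemma finite_pos_bound (R : realType) (T : finType) (f : T -> R) :
  (forall x, 0 < f x) -> exists2 k, 0 < k & forall x, k <= f x.
Proof.
move=> f0; have [M M0 fM] := @finite_bound R T (fun x => (f x)^-1).
exists M^-1 => [|x]; first by rewrite invr_gt0.
by rewrite -(invrK (f x)) lef_pV2 ?posrE ?invr_gt0.
Qed.

(** A form of Fekete's lemma that tolerates both a bounded error [C] and a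
    shift [a] of the argument: superadditivity need only hold up to a delay.
    The limit is the supremum of [(g s - C) / (s + a)]; writing a large [s] as
    [k (s0 + a) + r] with [r] bounded shows that no [g s / s] can fall much
    below the quotient at [s0]. *)
Lemma shifted_fekete (R : realType) (g : R -> R) (a C K : R) : 0 < a -> 0 <= K ->
  (forall s r, 0 < s -> 0 < r -> g s + g r - C <= g (s + r + a)) ->
  (forall s, 0 < s -> `|g s| <= K * (1 + s)) ->
  exists L, forall eps, 0 < eps ->
    exists2 s0, 0 < s0 & forall s, s0 <= s -> `|g s - L * s| <= eps * s.
Proof.
move=> a0 K0 gsup gbnd.
set h := fun s => (g s - C) / (s + a).
set A := [set h s | s in [set s | 0 < s]].
have hub : has_ubound A.
  exists (K + (K + `|C|) / a) => _ [s /= s0 <-].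
  rewrite /h ler_pdivrMr; last lra.
  have := gbnd s s0; rewrite ler_norml => /andP[_ h1].
  have h2 : - C <= `|C| by rewrite -normrN ler_norm.
  have h3 : 0 <= (K + `|C|) / a * s.
    by rewrite mulr_ge0 ?divr_ge0 ?addr_ge0 // ltW.
  have h4 : (K + `|C|) / a * a = K + `|C| by rewrite divfK // gt_eqF.
  have : 0 <= K * a by apply: mulr_ge0 => //; apply: ltW.
  lra.
have A0 : A !=set0 by exists (h 1), 1 => //=.
exists (sup A) => eps eps0; set L := sup A.
have gub s : 0 < s -> g s <= L * (s + a) + C.
  move=> s0; have : h s <= L by apply: ub_le_sup => //; exists s.
  rewrite /h ler_pdivrMr; lra.
have [_ [s0 /= s0p <-]] := sup_adherent (divr_gt0 eps0 (@ltr0n R 2)) (conj A0 hub).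
rewrite -/L /h ltr_pdivlMr; last lra; move=> hs0.
set b := s0 + a; have b0 : 0 < b by rewrite /b; lra.
have iter k r : 0 < r -> k%:R * (g s0 - C) + g r <= g (k%:R * b + r).
  move=> r0; elim: k => [|k IH]; first by rewrite !mul0r !add0r.
  have kr : 0 < k%:R * b + r by rewrite ltr_wpDl // mulr_ge0 // ltW.
  have := gsup _ _ s0p kr.
  have -> : s0 + (k%:R * b + r) + a = k.+1%:R * b + r.
    by rewrite -natr1 mulrDl mul1r {3}/b; ring.
  rewrite -natr1; lra.
(* s1 absorbs the contribution of the bounded remainder r in s = k b + r, and s2
   the shift and the constant in the upper bound. *)
have hA0 : 0 < eps / 2 by lra.
have [s1 s1p hs1] := eventually_le_linear (2 * b * (`|L| + eps) + K * (1 + 2 * b)) hA0.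
have [s2 s2p hs2] := eventually_le_linear (L * a + C) eps0.
exists (s1 + s2 + b) => [|s hs]; first lra.
have sp : 0 < s by lra.
rewrite ler_norml; apply/andP; split; last first.
  have := gub s sp; have := hs2 s; lra.
(* One multiple of b is kept back so that the remainder lies in [b, 2 b): the
   superadditivity is only known for positive arguments. *)
have q0 : 0 <= (s - b) / b by apply: divr_ge0; lra.
have := truncn_itv q0; set k := Num.truncn _ => /andP[].
rewrite ler_pdivlMr // ltr_pdivrMr // -natr1 mulrDl mul1r => kl ku.
have rp : 0 < s - k%:R * b by lra.
have := iter k _ rp; rewrite subrKC => hk.
have := gbnd _ rp; rewrite ler_norml => /andP[hr _].
have hk2 : k%:R * ((L - eps / 2) * b) <= k%:R * (g s0 - C).
  by apply: ler_wpM2l => //; rewrite -/b in hs0; lra.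
have hKr : K * (1 + (s - k%:R * b)) <= K * (1 + 2 * b).
  by apply: ler_wpM2l => //; lra.
have hLr : (L - eps / 2) * (s - k%:R * b) <= 2 * b * (`|L| + eps).
  apply: (@le_trans _ _ ((`|L| + eps) * (s - k%:R * b))).
    by apply: ler_wpM2r; [lra|have := ler_norm L; lra].
  rewrite [X in _ <= X]mulrC; apply: ler_wpM2l; last lra.
  by apply: addr_ge0 => //; lra.
have := hs1 s.
have e1 : (L - eps / 2) * (s - k%:R * b) = L * s - eps / 2 * s - k%:R * ((L - eps / 2) * b) by ring.
rewrite e1 in hLr.
by move=> /(_ ltac:(lra)); lra.
Qed.

(** * Finite and infinite paths *)

Fixpoint gcat (G : digraph) (u v w : G) (p : gpath u v) (q : gpath v w) :
    gpath u w :=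
  match q in gpath _ w return gpath u w with
  | pnil => p
  | psnoc _ _ q' e => psnoc (gcat p q') e
  end.

Lemma edges_gcat (G : digraph) (u v w : G) (p : gpath u v) (q : gpath v w) :
  edges (gcat p q) = edges p ++ edges q.
Proof. by elim: q => [|w1 w2 q IH e] /=; rewrite ?cats0 // IH rcons_cat. Qed.

Lemma edges_fst (G : digraph) (u v : G) (p : gpath u v) (e0 : edge G) :
  (0 < size (edges p))%N -> (tag (nth e0 (edges p) 0)).1 = u.
Proof.
have nil_src w (q : gpath u w) : size (edges q) = 0%N -> w = u.
  by case: q => //= v1 w' q e; rewrite size_rcons.
elim: p => //= v1 w q IH e _; rewrite nth_rcons.
case: ltnP => [/IH //|]; rewrite leqn0 => /eqP h.
by rewrite h /= (nil_src _ _ h).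
Qed.

Lemma edges_lst (G : digraph) (u v : G) (p : gpath u v) (e0 : edge G) i :
  i.+1 = size (edges p) -> (tag (nth e0 (edges p) i)).2 = v.
Proof.
case: p => //= v1 w q e; rewrite size_rcons => -[->].
by rewrite nth_rcons ltnn eqxx.
Qed.

Lemma edges_consecutive (G : digraph) (u v : G) (p : gpath u v) (e0 : edge G) i :
  (i.+1 < size (edges p))%N ->
  (tag (nth e0 (edges p) i)).2 = (tag (nth e0 (edges p) i.+1)).1.
Proof.
elim: p => //= v1 w q IH e; rewrite size_rcons ltnS => iq.
rewrite !nth_rcons iq; move: iq; rewrite leq_eqVlt => /predU1P[iq|iq].
  by rewrite -iq ltnn eqxx (edges_lst _ iq).
by rewrite iq; apply: IH.
Qed.

(** Appending an edge, as a total function on finite paths: it makes the end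
    of a path a function of its parent and its last edge as plain values, so that
    no equality between dependent pairs has to be inverted. *)
Definition extend_by (G : digraph) (p : finpath G) (a : edge G) : finpath G :=
  match fdst p =P (tag a).1 with
  | ReflectT h => FinPath (psnoc (walk p)
      (ecast v (Defs.arc v (tag a).2) (esym h) (tagged a)))
  | ReflectF _ => p
  end.

Lemma psnoc_extend_by (G : digraph) (u v w : G) (p : gpath u v) (e : Defs.arc v w) :
  FinPath (psnoc p e) = extend_by (FinPath p) (mk_edge e).
Proof.
rewrite /extend_by /=; case: eqP => // h.
by rewrite (eq_axiomK h).
Qed.

Lemma finpath_eq (G : digraph) (p q : finpath G) :
  fsrc p = fsrc q -> edges p = edges q -> p = q.
Proof.
case: p q => [u v p] [u' v' q] /= uu'; case: _ / uu' q => q {u'}.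
elim: p v' q => [|v1 w p IH e] v' [|v1' w' q e'] //=.
- by move/(congr1 size); rewrite size_rcons.
- by move/(congr1 size); rewrite size_rcons.
move=> /rcons_inj eq_pair; have pq := IH _ _ (congr1 fst eq_pair).
by rewrite !psnoc_extend_by pq (congr1 snd eq_pair : mk_edge e = mk_edge e').
Qed.

Lemma edges_itake (G : digraph) (g : infpath G) n :
  edges (itake g n) = mkseq (iedge g) n.
Proof. by elim: n => //= n ->; rewrite mkseqS. Qed.

Lemma itake_split (G : digraph) (g : infpath G) m n : (m <= n)%N ->
  exists q : gpath (ivtx g m) (ivtx g n), itake g n = gcat (itake g m) q.
Proof.
move=> /subnK <-; elim: (n - m)%N => [|k [q IH]]; first by exists pnil.
by exists (psnoc q (iarc g _)); rewrite /= IH.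
Qed.

Lemma mk_edge_cast (G : digraph) (a : edge G) v (h : (tag a).2 = v) :
  mk_edge (ecast v (Defs.arc (tag a).1 v) h (tagged a)) = a.
Proof. by case: _ / h; case: a => [[u w] a]. Qed.

(** The limit of a growing chain of finite paths. Its [n]-th edge is read off the
    [n.+1]-st path, which is long enough; the end of one edge and the beginning of
    the next agree only propositionally, whence the cast in its arcs. *)
Lemma chain_limit (G : digraph) (P : nat -> finpath G) :
  (forall k, fsrc (P k) = fsrc (P 0%N)) ->
  (forall k, exists s, edges (P k.+1) = edges (P k) ++ s) ->
  (forall k, (k <= size (edges (P k)))%N) ->
  exists g : infpath G, forall k, FinPath (itake g (size (edges (P k)))) = P k.
Proof.
move=> Psrc Pext Psize.
have [e0 _] : exists e0 : edge G, true.
  by move: (Psize 1%N); case: (edges _) => // a _ _; exists a.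
have Ple j k : (j <= k)%N -> exists s, edges (P k) = edges (P j) ++ s.
  move=> /subnK <-; elim: (k - j)%N => [|i [s IH]]; first by exists [::]; rewrite cats0.
  by rewrite addSn; have [s' ->] := Pext (i + j)%N; exists (s ++ s'); rewrite IH catA.
have Pnth j k i : (j <= k)%N -> (i < size (edges (P j)))%N ->
    nth e0 (edges (P k)) i = nth e0 (edges (P j)) i.
  by move=> /Ple[s ->] ij; rewrite nth_cat ij.
pose e n := nth e0 (edges (P n.+1)) n.
have eP k i : (i < size (edges (P k)))%N -> nth e0 (edges (P k)) i = e i.
  move=> ik; rewrite /e; have [ki|/ltnW ki] := leqP k i.+1; first by rewrite (Pnth k i.+1).
  by rewrite (Pnth i.+1 k) //; apply: Psize.
have e_adj n : (tag (e n)).2 = (tag (e n.+1)).1.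
  rewrite -(eP n.+2 n.+1) ?Psize // -(eP n.+2 n); last exact: ltnW (Psize n.+2).
  exact: edges_consecutive (Psize n.+2).
pose g := InfPath (fun n => ecast v (Defs.arc (tag (e n)).1 v) (e_adj n) (tagged (e n))).
have ge n : iedge g n = e n by rewrite /iedge /= mk_edge_cast.
exists g => k; apply: finpath_eq => /=.
  by rewrite -(eP 1%N) ?Psize // edges_fst ?Psize // !Psrc.
apply: etrans (edges_itake g _) _; apply: (@eq_from_nth _ e0); first by rewrite size_mkseq.
by move=> i; rewrite size_mkseq => ik; rewrite nth_mkseq // ge eP.
Qed.

(** * Norms of products of non-negative matrices *)

Lemma exists_max_term (R : realType) n (f : 'I_n -> R) : (0 < n)%N ->
  exists j, \sum_i f i <= n%:R * f j.
Proof.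
case: n f => // n f _; case: (@arg_maxP _ _ _ ord0 xpredT f) => // j _ fj.
exists j; have -> : n.+1%:R * f j = \sum_(i < n.+1) f j.
  by rewrite sumr_const card_ord mulr_natl.
by apply: ler_sum => i _; apply: fj.
Qed.

Lemma mxsum_mulmx (R : realType) m n p (A : 'M[R]_(m, n)) (B : 'M[R]_(n, p)) :
  mxsum (A *m B) = \sum_j (\sum_i A i j) * (\sum_k B j k).
Proof.
rewrite /mxsum; under eq_bigr => i _.
  under eq_bigr => k _ do rewrite mxE.
  rewrite exchange_big /=; over.
rewrite exchange_big /=; apply: eq_bigr => j _.
by rewrite mulr_suml; apply: eq_bigr => i _; rewrite mulr_sumr.
Qed.

Lemma sum_ge_term (R : realType) (I : finType) (f : I -> R) i :
  (forall j, 0 <= f j) -> f i <= \sum_j f j.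
Proof. by move=> f0; rewrite (bigD1 i) //= lerDl sumr_ge0. Qed.

Lemma mxsum_mulmx_le (R : realType) m n p (A : 'M[R]_(m, n)) (B : 'M[R]_(n, p)) :
  (forall i j, 0 <= A i j) -> (forall i j, 0 <= B i j) ->
  mxsum (A *m B) <= mxsum A * mxsum B.
Proof.
move=> A0 B0; rewrite mxsum_mulmx [mxsum A]exchange_big mulr_suml.
apply: ler_sum => j _; apply: ler_wpM2l; first exact: sumr_ge0.
by apply: (@sum_ge_term _ _ (fun j => \sum_k B j k)) => k; apply: sumr_ge0.
Qed.

Lemma mxsum_mulmx3_ge (R : realType) m n p q (A : 'M[R]_(m, n))
    (C : 'M[R]_(n, p)) (B : 'M[R]_(p, q)) j k :
  (forall i j, 0 <= A i j) -> (forall i j, 0 <= C i j) ->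
  (forall i j, 0 <= B i j) ->
  (\sum_i A i j) * C j k * (\sum_l B k l) <= mxsum (A *m C *m B).
Proof.
move=> A0 C0 B0; rewrite mxsum_mulmx.
have AC i l : 0 <= (A *m C) i l.
  by rewrite mxE sumr_ge0 // => s _; rewrite mulr_ge0.
apply: (@le_trans _ _ ((\sum_i (A *m C) i k) * (\sum_l B k l))).
  apply: ler_wpM2r; first exact: sumr_ge0.
  rewrite mulr_suml; apply: ler_sum => i _; rewrite mxE.
  by apply: (@sum_ge_term _ _ (fun s => A i s * C s k)) => s; rewrite mulr_ge0.
apply: (@sum_ge_term _ _ (fun k => (\sum_i (A *m C) i k) * (\sum_l B k l))).
by move=> s; rewrite mulr_ge0 // sumr_ge0.
Qed.

Lemma mxsum_ge0 (R : realType) m n (A : 'M[R]_(m, n)) :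
  (forall i j, 0 <= A i j) -> 0 <= mxsum A.
Proof. by move=> A0; apply: sumr_ge0 => i _; apply: sumr_ge0. Qed.

Lemma mxsum_ge_entry (R : realType) m n (A : 'M[R]_(m, n)) i j :
  (forall i j, 0 <= A i j) -> A i j <= mxsum A.
Proof.
move=> A0; apply: le_trans (sum_ge_term i _) => [|k]; last exact: sumr_ge0.
exact: (@sum_ge_term _ _ (A i)).
Qed.

Lemma mxsum_gt0 (R : realType) m n (A : 'M[R]_(m, n)) :
  (forall i j, 0 <= A i j) -> 0 < mxsum A -> exists i j, 0 < A i j.
Proof.
move=> A0; rewrite lt_neqAle eq_sym => /andP[Aneq0 _]; apply: contrapT => noA.
move/eqP: Aneq0; apply; rewrite /mxsum big1 // => i _; rewrite big1 // => j _.
apply/eqP; rewrite eq_le A0 andbT leNgt; apply/negP => Aij.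
by apply: noA; exists i, j.
Qed.

(** * Logarithmic lengths of paths *)

(** With the sign changed, both logarithms behave as lengths: [wlen] is
    non-negative and additive, [tlen] is superadditive, and the exponents are
    limits of [tlen / wlen]. *)
Definition wlen (R : realType) (G : mps R) (u v : G) (p : gpath u v) : R :=
  - ln (Wpath p).

Definition tlen (R : realType) (G : mps R) (u v : G) (p : gpath u v) : R :=
  - ln (mxsum (Tpath p)).

Definition nonzero (R : realType) (G : mps R) (u v : G) (p : gpath u v) : Prop :=
  0 < mxsum (Tpath p).

Section Lengths.
Variables (R : realType) (G : mps R).
Implicit Types u v w x : G.

Lemma Tpath_ge0 u v (p : gpath u v) i j : 0 <= Tpath p i j.
Proof.
elim: p i j => [|v1 w p IH e] i j /=; first by rewrite mxE; case: eqP.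
by rewrite mxE sumr_ge0 // => k _; rewrite mulr_ge0 // Tarc_ge0.
Qed.

Lemma Tpath_gcat u v w (p : gpath u v) (q : gpath v w) :
  Tpath (gcat p q) = Tpath p *m Tpath q.
Proof. by elim: q => [|w1 w2 q IH e] /=; rewrite ?mulmx1 // IH mulmxA. Qed.

Lemma Wpath_gcat u v w (p : gpath u v) (q : gpath v w) :
  Wpath (gcat p q) = Wpath p * Wpath q.
Proof. by elim: q => [|w1 w2 q IH e] /=; rewrite ?mulr1 // IH mulrA. Qed.

Lemma Wpath_gt0 u v (p : gpath u v) : 0 < Wpath p.
Proof. by elim: p => //= v1 w p IH e; rewrite mulr_gt0 // Warc_gt0. Qed.

Lemma wlen_nil u : wlen (@pnil G u) = 0.
Proof. by rewrite /wlen /= ln1 oppr0. Qed.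

Lemma wlen_snoc u v w (p : gpath u v) (e : Defs.arc v w) :
  wlen (psnoc p e) = wlen p - ln (Warc e).
Proof. by rewrite /wlen /= lnM ?posrE ?Wpath_gt0 ?Warc_gt0 // opprD. Qed.

Lemma wlen_gcat u v w (p : gpath u v) (q : gpath v w) :
  wlen (gcat p q) = wlen p + wlen q.
Proof. by rewrite /wlen Wpath_gcat lnM ?posrE ?Wpath_gt0 // opprD. Qed.

Lemma arc_bound (f : forall u v, Defs.arc u v -> R) :
  exists2 M, 0 < M & forall u v (e : Defs.arc u v), f u v e <= M.
Proof.
pose T : finType := {uv : G * G & Defs.arc uv.1 uv.2}.
have [M M0 fM] := @finite_bound R T (fun a => f _ _ (tagged a)).
by exists M => // u v e; apply: (fM (mk_edge e)).
Qed.

(** Comparing [wlen] with the number of edges rests on the weights being bounded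
    away from both 0 and 1. *)
Lemma arc_wlen_bounds : exists kappa sigma : R, [/\ 0 < kappa, 0 < sigma &
  forall u v (e : Defs.arc u v), kappa <= - ln (Warc e) <= sigma].
Proof.
pose T : finType := {uv : G * G & Defs.arc uv.1 uv.2}.
have [|k k0 hk] := @finite_pos_bound R T (fun a => - ln (Warc (tagged a))).
  by move=> a; rewrite oppr_gt0 ln_lt0 // Warc_gt0 Warc_lt1.
have [M M0 hM] := arc_bound (fun u v e => - ln (Warc e)).
exists k, M; split=> // u v e; apply/andP; split; last exact: hM.
exact: (hk (mk_edge e)).
Qed.

Lemma wlen_size kappa sigma u v (p : gpath u v) :
  (forall u v (e : Defs.arc u v), kappa <= - ln (Warc e) <= sigma) ->
  kappa * (size (edges p))%:R <= wlen p <= sigma * (size (edges p))%:R.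
Proof.
move=> arcW; elim: p => [|v1 w p IH e]; first by rewrite wlen_nil !mulr0 lexx.
rewrite wlen_snoc /= size_rcons -natr1; have := arcW _ _ e; lra.
Qed.

Lemma wlen_ge0 u v (p : gpath u v) : 0 <= wlen p.
Proof.
have [k [s [k0 _ arcW]]] := arc_wlen_bounds.
have /andP[+ _] := wlen_size p arcW; apply: le_trans.
by rewrite mulr_ge0 // ltW.
Qed.

Lemma nonzero_nil u : nonzero (@pnil G u).
Proof.
apply: lt_le_trans (mxsum_ge_entry (Ordinal (dimv_gt0 u)) (Ordinal (dimv_gt0 u)) _).
  by rewrite /= mxE eqxx.
exact: Tpath_ge0.
Qed.

Lemma nonzero_gcat u v w (p : gpath u v) (q : gpath v w) :
  nonzero (gcat p q) -> nonzero p /\ nonzero q.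
Proof.
rewrite /nonzero Tpath_gcat => pq0.
have := lt_le_trans pq0 (mxsum_mulmx_le (@Tpath_ge0 _ _ p) (@Tpath_ge0 _ _ q)).
have := mxsum_ge0 (@Tpath_ge0 _ _ p); have := mxsum_ge0 (@Tpath_ge0 _ _ q).
rewrite !le_eqVlt => /predU1P[<-|q0] /predU1P[<-|p0] //.
- by rewrite mulr0 ltxx.
- by rewrite mulr0 ltxx.
- by rewrite mul0r ltxx.
Qed.

Lemma tlen_gcat u v w (p : gpath u v) (q : gpath v w) :
  nonzero (gcat p q) -> tlen p + tlen q <= tlen (gcat p q).
Proof.
move=> pq0; have [p0 q0] := nonzero_gcat pq0.
rewrite /tlen -opprD lerN2 -lnM ?posrE // ler_ln ?posrE ?mulr_gt0 //.
by rewrite Tpath_gcat mxsum_mulmx_le //; apply: Tpath_ge0.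
Qed.

(** A positive entry of a product dominates a product of positive entries of
    the factors, of which there are finitely many; so both the entries and
    the norms are controlled by the number of factors, hence by [wlen]. *)
Lemma tlen_bound : exists2 K : R, 0 < K &
  (forall u v (p : gpath u v) i j, 0 < Tpath p i j ->
     - ln (Tpath p i j) <= K * wlen p) /\
  (forall u v (p : gpath u v), nonzero p -> `|tlen p| <= K * (1 + wlen p)).
Proof.
have [k [s [k0 _ arcW]]] := arc_wlen_bounds.
have [K1 K10 hK1] := arc_bound (fun u v e => ln (mxsum (Tarc e))).
have [K2 K20 hK2] := arc_bound (fun u v e => \sum_a \sum_b `|ln (Tarc e a b)|).
have [K3 K30 hK3] := @finite_bound R G (fun u => ln (mxsum (Tpath (@pnil G u)))).
pose K := (K1 + K2) / k + K3.
have Kk : (K1 + K2) / k * k = K1 + K2 by rewrite divfK // gt_eqF.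
have Kk0 : 0 < (K1 + K2) / k by rewrite divr_gt0 // addr_gt0.
have K0 : 0 < K by rewrite /K addr_gt0.
have arcK u v (e : Defs.arc u v) : K1 + K2 <= (K1 + K2) / k * - ln (Warc e).
  rewrite -{1}Kk; apply: ler_wpM2l; first exact: ltW.
  by have /andP[] := arcW _ _ e.
have entry u v (p : gpath u v) i j : 0 < Tpath p i j ->
    - ln (Tpath p i j) <= (K1 + K2) / k * wlen p.
  elim: p i j => [|v1 w p IH e] i j.
    rewrite wlen_nil mulr0 /= mxE; case: eqP => /=; last by rewrite ltxx.
    by rewrite ln1 oppr0.
  rewrite wlen_snoc /= mxE => Tij.
  have [l] : exists l, 0 < Tpath p i l * Tarc e l j.
    apply: contrapT => nol; move: Tij; rewrite big1 ?ltxx // => l _.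
    apply/eqP; rewrite eq_le mulr_ge0 ?Tpath_ge0 ?Tarc_ge0 // andbT leNgt.
    by apply/negP => h; apply: nol; exists l.
  have := Tpath_ge0 p i l; have := Tarc_ge0 e l j.
  rewrite !le_eqVlt => /predU1P[<-|e0]; first by rewrite mulr0 ltxx.
  move=> /predU1P[<-|p0]; first by rewrite mul0r ltxx.
  move=> pe0; have hl : Tpath p i l * Tarc e l j <= \sum_j0 Tpath p i j0 * Tarc e j0 j.
    apply: (@sum_ge_term _ _ (fun l => Tpath p i l * Tarc e l j)) => m.
    by rewrite mulr_ge0 ?Tpath_ge0 ?Tarc_ge0.
  move: hl; rewrite -ler_ln ?posrE // lnM ?posrE //.
  have := IH _ _ p0; have := arcK _ _ e; have := hK2 _ _ e.
  have : `|ln (Tarc e l j)| <= \sum_a \sum_b `|ln (Tarc e a b)|.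
    apply: le_trans (sum_ge_term l _) => [|a]; last exact: sumr_ge0.
    exact: (@sum_ge_term _ _ (fun b => `|ln (Tarc e l b)|)).
  have := ler_norm (- ln (Tarc e l j)); rewrite normrN; lra.
have lower u v (p : gpath u v) : nonzero p ->
    - K3 - (K1 + K2) / k * wlen p <= tlen p.
  elim: p => [|v1 w p IH e] p0.
    rewrite wlen_nil mulr0 subr0 lerN2; exact: hK3.
  rewrite wlen_snoc; have arcE : psnoc p e = gcat p (psnoc pnil e) by [].
  rewrite arcE in p0 *; have [/IH IHp _] := nonzero_gcat p0.
  have := tlen_gcat p0; rewrite {2}/tlen /= mul1mx.
  have := hK1 _ _ e; have := arcK _ _ e; lra.
have wK u v (p : gpath u v) : (K1 + K2) / k * wlen p <= K * wlen p.
  by apply: ler_wpM2r; [exact: wlen_ge0|rewrite lerDl ltW].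
exists K => //; split=> [u v p i j pij|u v p p0].
  exact: le_trans (entry _ _ _ _ _ pij) (wK _ _ _).
have := lower _ _ _ p0; have := wK _ _ p.
have [i [j ij]] := mxsum_gt0 (@Tpath_ge0 _ _ p) p0.
have := entry _ _ _ _ _ ij.
have := mxsum_ge_entry i j (@Tpath_ge0 _ _ p); rewrite -ler_ln ?posrE //.
rewrite ler_norml /tlen /K; have := wlen_ge0 p; lra.
Qed.

End Lengths.

(** * Cutting, extending and splicing paths *)

Lemma gcat_nil (G : digraph) (u v : G) (p : gpath u v) : gcat pnil p = p.
Proof. by elim: p => //= v1 w p -> e. Qed.

Lemma gcatA (G : digraph) (u v w x : G) (p : gpath u v) (q : gpath v w)
    (r : gpath w x) :
  gcat p (gcat q r) = gcat (gcat p q) r.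
Proof. by elim: r => //= v1 w1 r -> e. Qed.

Section Splicing.
Variables (R : realType) (G : mps R).
Implicit Types u v w x : G.

(** The lower bound on the length of a connecting path, which comes from its having
    at least one edge, allows paths to be prolonged indefinitely. *)
Lemma uniform_connectors : irreducible_mps G ->
  exists kappa M : R, [/\ 0 < kappa, 0 < M &
    forall u v (i : 'I_(Defs.dimv u)) (j : 'I_(Defs.dimv v)), exists r : gpath u v,
      0 < Tpath r i j /\ kappa <= wlen r <= M].
Proof.
move=> [H [_ Hsize Hconn]].
have [k [s [k0 _ arcW]]] := arc_wlen_bounds G.
pose T : finType := {uv : G * G & ('I_(Defs.dimv uv.1) * 'I_(Defs.dimv uv.2))%type}.
have conn (a : T) : exists r : gpath (tag a).1 (tag a).2,
    0 < Tpath r (tagged a).1 (tagged a).2 /\ k <= wlen r.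
  have [r [Hr Tr]] := Hconn _ _ (tagged a).1 (tagged a).2.
  exists r; split=> //; have /andP[+ _] := wlen_size r arcW; apply: le_trans.
  by rewrite ler_pMr // ler1n; apply: Hsize Hr.
have [M M0 hM] := @finite_bound R T (fun a => wlen (projT1 (cid (conn a)))).
exists k, M; split=> // u v i j.
pose a : T := @Tagged _ (u, v) (fun uv => ('I_(Defs.dimv uv.1) * 'I_(Defs.dimv uv.2))%type) (i, j).
have := hM a; case: cid => r /= [Tr kr] rM.
by exists r; rewrite kr.
Qed.

(** Quasi-multiplicativity: choosing the connecting path between the heaviest
    column of the first matrix and the heaviest row of the second one bounds the
    norm of the product from below by that of the factors. *)
Lemma splice : irreducible_mps G ->
  exists kappa M C : R, [/\ 0 < kappa, 0 < M &
    forall u v v' w (p : gpath u v) (q : gpath v' w), nonzero p -> nonzero q ->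
      exists r : gpath v v', [/\ nonzero (gcat (gcat p r) q),
        tlen (gcat (gcat p r) q) <= tlen p + tlen q + C & kappa <= wlen r <= M]].
Proof.
move=> /uniform_connectors[k [M [k0 M0 conn]]].
have [K K0 [entry _]] := tlen_bound G.
have [D _ hD] := @finite_bound R G (fun u => ln ((Defs.dimv u)%:R)).
exists k, M, (2 * D + K * M); split=> // u v v' w p q p0 q0.
have [j hj] := exists_max_term (fun j => \sum_i Tpath p i j) (dimv_gt0 v).
have [l hl] := exists_max_term (fun l => \sum_i Tpath q l i) (dimv_gt0 v').
rewrite exchange_big /= -/(mxsum _) in hj; rewrite -/(mxsum _) in hl.
have [r [Tr /andP[kr rM]]] := conn _ _ j l; exists r.
have dpos u' : 0 < (Defs.dimv u')%:R :> R by rewrite ltr0n dimv_gt0.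
have cp : 0 < \sum_i Tpath p i j by have := lt_le_trans p0 hj; rewrite pmulr_rgt0.
have cq : 0 < \sum_i Tpath q l i by have := lt_le_trans q0 hl; rewrite pmulr_rgt0.
have := mxsum_mulmx3_ge j l (@Tpath_ge0 _ _ _ _ p) (@Tpath_ge0 _ _ _ _ r) (@Tpath_ge0 _ _ _ _ q).
rewrite -!Tpath_gcat => h.
have h0 : nonzero (gcat (gcat p r) q) by apply: lt_le_trans h; rewrite !mulr_gt0.
split=> //; last by rewrite kr.
rewrite -ler_ln ?posrE ?mulr_gt0 // !lnM ?posrE ?mulr_gt0 // in h.
rewrite -ler_ln ?posrE ?mulr_gt0 // lnM ?posrE // in hj.
rewrite -ler_ln ?posrE ?mulr_gt0 // lnM ?posrE // in hl.
have := hD v; have := hD v'; have := entry _ _ _ _ _ Tr.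
have : K * wlen r <= K * M by rewrite ler_wpM2l // ltW.
rewrite /tlen; lra.
Qed.

(** In terms of [s = - ln t], membership in [Sigma_t t] means that the last edge is
    the one that takes [wlen] past [s]. *)
Lemma SigmaP s u v w (p : gpath u v) (e : Defs.arc v w) :
  Sigma_t (expR (- s)) (FinPath (psnoc p e)) <->
  nonzero (psnoc p e) /\ wlen p <= s < wlen (psnoc p e).
Proof.
have le_wlen u' v' (p' : gpath u' v') : (expR (- s) <= Wpath p') = (wlen p' <= s).
  by rewrite -[Wpath p']lnK ?posrE ?Wpath_gt0 // ler_expR lerNl.
have := le_wlen _ _ p; have := le_wlen _ _ (psnoc p e).
rewrite [s < _]ltNge /Sigma_t /= => <- <-.
by rewrite -ltNge andbC; split=> -[].
Qed.

Lemma Sigma_bounds sigma s (p : finpath G) :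
  (forall u v (e : Defs.arc u v), - ln (Warc e) <= sigma) ->
  Sigma_t (expR (- s)) p -> nonzero p /\ s < wlen p <= s + sigma.
Proof.
move=> arcW; case: p => u v [|v1 w p e].
  by move=> [/andP[/= h1 h2]]; have := lt_le_trans h1 h2; rewrite ltxx.
move/SigmaP=> /= [p0 /andP[ps ->]]; split=> //=.
by rewrite wlen_snoc; apply: lerD.
Qed.

(** Cutting [gcat p q] at the edge of [q] where [wlen] passes [s]. With [p] empty it
    isolates an initial segment; with [q] long it prolongs [p] to a path in
    [Sigma_t]. *)
Lemma Sigma_cut s u v w (p : gpath u v) (q : gpath v w) :
  nonzero (gcat p q) -> wlen p <= s < wlen (gcat p q) ->
  exists x (q1 : gpath v x) (q2 : gpath x w),
    Sigma_t (expR (- s)) (FinPath (gcat p q1)) /\ q = gcat q1 q2.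
Proof.
elim: q => [|w1 w2 q IH e] /= pq0 /andP[ps sq].
  by have := le_lt_trans ps sq; rewrite ltxx.
have [sq'|qs] := ltP s (wlen (gcat p q)).
  have arcE : psnoc (gcat p q) e = gcat (gcat p q) (psnoc pnil e) by [].
  rewrite arcE in pq0; have [pq _] := nonzero_gcat pq0.
  have [|x [q1 [q2 [q1S ->]]]] := IH pq; first by rewrite ps.
  by exists x, q1, (psnoc q2 e).
exists w2, (psnoc q e), pnil; split=> //=.
by apply/SigmaP; split=> //; rewrite qs.
Qed.

Lemma Sigma_prefix s u v (p : gpath u v) : nonzero p -> 0 <= s < wlen p ->
  exists x (p1 : gpath u x) (p2 : gpath x v),
    Sigma_t (expR (- s)) (FinPath p1) /\ p = gcat p1 p2.
Proof.
move=> p0 sp; have [||x [p1 [p2 [p1S pE]]]] := @Sigma_cut s _ _ _ pnil p.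
- by rewrite gcat_nil.
- by rewrite gcat_nil wlen_nil.
by exists x, p1, p2; rewrite gcat_nil in p1S.
Qed.

Lemma Sigma_extend s u v (p : gpath u v) : irreducible_mps G ->
  nonzero p -> wlen p <= s ->
  exists w (q : gpath v w), Sigma_t (expR (- s)) (FinPath (gcat p q)).
Proof.
move=> irrG p0 ps; have [k [M [C [k0 _ hsplice]]]] := splice irrG.
(* Repeated splicing with empty paths prolongs p beyond any bound. *)
have long n : exists w (q : gpath v w), nonzero (gcat p q) /\
    k * n%:R <= wlen (gcat p q).
  elim: n => [|n [w [q [pq nq]]]].
    by exists v, pnil; rewrite mulr0; split=> //; apply: wlen_ge0.
  have [r [rq _ /andP[kr _]]] := hsplice _ _ _ _ _ _ pq (nonzero_nil w).
  have rE : gcat p (gcat q r) = gcat (gcat (gcat p q) r) pnil.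
    exact: gcatA.
  exists w, (gcat q r); rewrite rE; split=> //.
  by rewrite /= wlen_gcat -natr1 mulrDr mulr1 lerD.
have [w [q [pq sq]]] := long (Num.truncn (s / k)).+1.
have [|x [q1 [q2 [q1S _]]]] := @Sigma_cut s _ _ _ p q pq; last by exists x, q1.
rewrite ps /=; apply: lt_le_trans sq.
by rewrite mulrC -ltr_pdivrMr // truncnS_gt.
Qed.

End Splicing.

(** * Existence of the extremal exponents *)

Definition inf_ratio (R : realType) (G : mps R) (t : R) : R :=
  inf [set log_ratio t p | p in @Sigma_t R G t].

Definition sup_ratio (R : realType) (G : mps R) (t : R) : R :=
  sup [set log_ratio t p | p in @Sigma_t R G t].

Lemma lim_at0_expR (R : realType) (F : R -> R) (L : R) :
  (forall eps, 0 < eps -> exists2 s0, 0 < s0 &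
     forall s, s0 <= s -> `|s * F (expR (- s)) - L * s| <= eps * s) ->
  lim (F t @[t --> (0 : R)^'+]) = L.
Proof.
move=> hL; apply: cvg_lim => //; apply/cvgrPdist_le => eps eps0.
have [s0 s00 hs] := hL _ eps0.
near=> t.
have t0 : 0 < t by near: t; apply: nbhs_right_gt.
have ts : t < expR (- s0) by near: t; apply: nbhs_right_lt; apply: expR_gt0.
have sle : s0 <= - ln t.
  rewrite lerNr -[- s0]expRK ler_ln ?posrE ?expR_gt0 //; exact: ltW.
have sp : 0 < - ln t by apply: lt_le_trans sle.
have := hs _ sle; rewrite opprK lnK ?posrE // [L * _]mulrC -mulrBr normrM.
by rewrite (gtr0_norm sp) mulrC ler_pM2r // distrC.
Unshelve. all: by end_near.
Qed.

Section GrowthLimits.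
Variables (R : realType) (G : mps R) (irrG : irreducible_mps G) (x0 : G).
Implicit Types u v w : G.

Lemma log_ratioE s u v (p : gpath u v) :
  log_ratio (expR (- s)) (FinPath p) = tlen p / s.
Proof. by rewrite /log_ratio expRK /tlen invrN mulrN mulNr. Qed.

Lemma Sigma_nonempty s : 0 <= s -> exists p, @Sigma_t R G (expR (- s)) p.
Proof.
move=> s0; have [|w [q qS]] := Sigma_extend irrG (nonzero_nil x0) (s := s).
  by rewrite wlen_nil.
by exists (FinPath (gcat pnil q)).
Qed.

Lemma Sigma_tlen_bound : exists2 B : R, 0 < B & forall s (p : finpath G), 0 < s ->
  Sigma_t (expR (- s)) p -> `|tlen p| <= B * (1 + s).
Proof.
have [k [sigma [_ sg0 arcW]]] := arc_wlen_bounds G.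
have [K K0 [_ hK]] := tlen_bound G.
exists (K * (1 + sigma)) => [|s p s0 pS]; first by rewrite mulr_gt0 // addr_gt0.
have [] := Sigma_bounds (sigma := sigma) _ pS => [u v e|p0 /andP[_ ps]].
  by have /andP[] := arcW _ _ e.
apply: le_trans (hK _ _ _ p0) _; rewrite -mulrA ler_wpM2l ?(ltW K0) //.
have : 0 <= sigma * s by rewrite mulr_ge0 // ltW.
lra.
Qed.

Let ratios s := [set log_ratio (expR (- s)) p | p in @Sigma_t R G (expR (- s))].

Lemma has_inf_sup_ratios s : 0 < s -> has_inf (ratios s) /\ has_sup (ratios s).
Proof.
move=> s0; have [B B0 hB] := Sigma_tlen_bound.
have [p pS] := Sigma_nonempty (ltW s0).
have ne : ratios s !=set0 by exists (log_ratio (expR (- s)) p), p.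
have bnd (q : finpath G) : Sigma_t (expR (- s)) q ->
    - (B * (1 + s) / s) <= log_ratio (expR (- s)) q <= B * (1 + s) / s.
  move=> qS; have := hB _ _ s0 qS; rewrite ler_norml; case: q qS => u v q _ /= /andP[ql qu].
  by rewrite log_ratioE -mulNr !ler_pM2r ?invr_gt0 // ql.
split; split=> //.
- by exists (- (B * (1 + s) / s)) => _ [q /bnd/andP[h _] <-].
- by exists (B * (1 + s) / s) => _ [q /bnd/andP[_ h] <-].
Qed.

Lemma inf_ratio_le s (p : finpath G) : 0 < s -> Sigma_t (expR (- s)) p ->
  s * inf_ratio G (expR (- s)) <= tlen p.
Proof.
move=> s0 pS; rewrite mulrC -ler_pdivlMr //; case: p pS => u v p pS.
rewrite /= -log_ratioE; apply: ge_inf; last by exists (FinPath p).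
by have [[_ ?] _] := has_inf_sup_ratios s0.
Qed.

Lemma sup_ratio_ge s (p : finpath G) : 0 < s -> Sigma_t (expR (- s)) p ->
  tlen p <= s * sup_ratio G (expR (- s)).
Proof.
move=> s0 pS; rewrite mulrC -ler_pdivrMr //; case: p pS => u v p pS.
rewrite /= -log_ratioE; apply: ub_le_sup; last by exists (FinPath p).
by have [_ [_ ?]] := has_inf_sup_ratios s0.
Qed.

Lemma le_inf_ratio s x : 0 < s ->
  (forall p : finpath G, Sigma_t (expR (- s)) p -> x <= tlen p) ->
  x <= s * inf_ratio G (expR (- s)).
Proof.
move=> s0 xp; rewrite mulrC -ler_pdivrMr //; apply: lb_le_inf.
  by have [[]] := has_inf_sup_ratios s0.
move=> _ [[u v p] pS <-]; rewrite log_ratioE ler_pM2r ?invr_gt0 //.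
exact: xp pS.
Qed.

Lemma sup_ratio_le s x : 0 < s ->
  (forall p : finpath G, Sigma_t (expR (- s)) p -> tlen p <= x) ->
  s * sup_ratio G (expR (- s)) <= x.
Proof.
move=> s0 xp; rewrite mulrC -ler_pdivlMr //; apply: ge_sup.
  by have [_ []] := has_inf_sup_ratios s0.
move=> _ [[u v p] pS <-]; rewrite log_ratioE ler_pM2r ?invr_gt0 //.
exact: xp pS.
Qed.

Lemma near_inf_ratio s : 0 < s -> exists2 p : finpath G,
  Sigma_t (expR (- s)) p & tlen p <= s * inf_ratio G (expR (- s)) + 1.
Proof.
move=> s0; apply: contrapT => noP.
suff : s * inf_ratio G (expR (- s)) + 1 <= s * inf_ratio G (expR (- s)) by lra.
apply: le_inf_ratio => // p pS; rewrite leNgt; apply/negP => /ltW h.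
by apply: noP; exists p.
Qed.

Lemma near_sup_ratio s : 0 < s -> exists2 p : finpath G,
  Sigma_t (expR (- s)) p & s * sup_ratio G (expR (- s)) - 1 <= tlen p.
Proof.
move=> s0; apply: contrapT => noP.
suff : s * sup_ratio G (expR (- s)) <= s * sup_ratio G (expR (- s)) - 1 by lra.
apply: sup_ratio_le => // p pS; rewrite leNgt; apply/negP => /ltW h.
by apply: noP; exists p.
Qed.

Lemma ratio_bounds (B s : R) : 0 < s ->
  (forall p : finpath G, Sigma_t (expR (- s)) p -> `|tlen p| <= B) ->
  `|s * inf_ratio G (expR (- s))| <= B /\ `|s * sup_ratio G (expR (- s))| <= B.
Proof.
move=> s0 hB; rewrite !ler_norml.
have [p pS] := Sigma_nonempty (ltW s0).
have bnd (q : finpath G) : Sigma_t (expR (- s)) q -> - B <= tlen q <= B.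
  by move=> qS; rewrite -ler_norml hB.
have /andP[pl pu] := bnd _ pS.
split; apply/andP; split.
- by apply: le_inf_ratio => // q /bnd/andP[].
- exact: le_trans (inf_ratio_le s0 pS) pu.
- exact: le_trans pl (sup_ratio_ge s0 pS).
- by apply: sup_ratio_le => // q /bnd/andP[].
Qed.

(** Every path whose length has just passed [s + r + a] is cut into one that has just
    passed [s], one that has just passed [r], and a remainder of bounded length. The
    delay [a], the maximal length of an edge, pays for the overshoot of the first
    piece, so that enough remains for the second. *)
Lemma inf_ratio_superadditive : exists a C : R, 0 < a /\
  forall s r, 0 < s -> 0 < r ->
    s * inf_ratio G (expR (- s)) + r * inf_ratio G (expR (- r)) - C <=
    (s + r + a) * inf_ratio G (expR (- (s + r + a))).
Proof.
have [k [a [_ a0 arcW]]] := arc_wlen_bounds G.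
have arcWu u v (e : Defs.arc u v) : - ln (Warc e) <= a.
  by have /andP[] := arcW _ _ e.
have [K K0 [_ hK]] := tlen_bound G.
exists a, (K * (1 + (a + a))); split=> // s r s0 r0.
apply: le_inf_ratio => [|p pS]; first by rewrite !addr_gt0.
have [p0 /andP[pl pu]] := Sigma_bounds arcWu pS.
case: p {pS} p0 pl pu => u v p /= p0 pl pu.
have [|x [p1 [p' [p1S pE]]]] := @Sigma_prefix _ _ s _ _ p p0; first lra.
have [_ /andP[/= p1l p1u]] := Sigma_bounds arcWu p1S.
rewrite pE in p0; have [_ p'0] := nonzero_gcat p0.
rewrite pE wlen_gcat in pl pu.
have [|y [p2 [p3 [p2S p'E]]]] := @Sigma_prefix _ _ r _ _ p' p'0; first lra.
have [_ /andP[/= p2l _]] := Sigma_bounds arcWu p2S.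
rewrite p'E in p'0 p0; have [_ p30] := nonzero_gcat p'0.
rewrite p'E wlen_gcat in pl pu.
rewrite pE p'E; have := tlen_gcat p0; have := tlen_gcat p'0.
have := inf_ratio_le s0 p1S; have := inf_ratio_le r0 p2S.
have := hK _ _ _ p30; rewrite ler_norml => /andP[+ _].
have : K * (1 + wlen p3) <= K * (1 + (a + a)) by rewrite ler_wpM2l ?(ltW K0) //; lra.
rewrite /=; lra.
Qed.

(** Splicing two paths overshoots [s + r] by a bounded amount. Shortening the
    result would not do, since the norm could increase without control; so the delay
    [a] is taken larger than the overshoot and the result is prolonged to length
    [s + r + a]. Prolonging only increases [tlen], up to a constant. *)
Lemma sup_ratio_superadditive : exists a C : R, 0 < a /\
  forall s r, 0 < s -> 0 < r ->
    s * sup_ratio G (expR (- s)) + r * sup_ratio G (expR (- r)) - C <=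
    (s + r + a) * sup_ratio G (expR (- (s + r + a))).
Proof.
have [k [sg [_ sg0 arcW]]] := arc_wlen_bounds G.
have arcWu u v (e : Defs.arc u v) : - ln (Warc e) <= sg.
  by have /andP[] := arcW _ _ e.
have [K K0 [_ hK]] := tlen_bound G.
have [k' [M [C [k'0 M0 hsplice]]]] := splice irrG.
pose a := sg + sg + M.
pose C' := K * (1 + M) + K * (1 + (a + sg)).
exists a, C'; split=> [|s r s0 r0]; first by rewrite !addr_gt0.
set X := (s + r + a) * _.
have hX (p q : finpath G) : Sigma_t (expR (- s)) p -> Sigma_t (expR (- r)) q ->
    tlen p + tlen q <= X + C'.
  move=> pS qS; have [p0 /andP[pl pu]] := Sigma_bounds arcWu pS.
  have [q0 /andP[ql qu]] := Sigma_bounds arcWu qS.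
  have [x [pxq0 _ /andP[xl xu]]] := hsplice _ _ _ _ _ _ p0 q0.
  have [|w [y yS]] := Sigma_extend (s := s + r + a) irrG pxq0.
    by rewrite !wlen_gcat /a; lra.
  have [y0 /andP[/= _ yu]] := Sigma_bounds arcWu yS.
  have := sup_ratio_ge _ yS; rewrite -/X => /(_ ltac:(rewrite !addr_gt0)) /= hy.
  have [_ yn] := nonzero_gcat y0.
  have [px0 _] := nonzero_gcat pxq0; have [_ xn] := nonzero_gcat px0.
  have := tlen_gcat y0; have := tlen_gcat pxq0; have := tlen_gcat px0.
  rewrite !wlen_gcat in yu.
  have := hK _ _ _ yn; rewrite ler_norml => /andP[+ _].
  have := hK _ _ _ xn; rewrite ler_norml => /andP[+ _].
  have : K * (1 + wlen x) <= K * (1 + M) by rewrite ler_wpM2l ?(ltW K0) //; lra.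
  have : K * (1 + wlen y) <= K * (1 + (a + sg)) by rewrite ler_wpM2l ?(ltW K0) //; lra.
  rewrite /C'; lra.
have hs (q : finpath G) : Sigma_t (expR (- r)) q ->
    s * sup_ratio G (expR (- s)) <= X + C' - tlen q.
  by move=> qS; apply: sup_ratio_le => // p pS; have := hX _ _ pS qS; lra.
have : r * sup_ratio G (expR (- r)) <= X + C' - s * sup_ratio G (expR (- s)).
  by apply: sup_ratio_le => // q /hs; lra.
lra.
Qed.

Lemma superadditive_ratio_limit (F : R -> R) :
  (exists a C : R, 0 < a /\ forall s r, 0 < s -> 0 < r ->
    s * F (expR (- s)) + r * F (expR (- r)) - C <=
    (s + r + a) * F (expR (- (s + r + a)))) ->
  (exists2 K, 0 < K & forall s, 0 < s -> `|s * F (expR (- s))| <= K * (1 + s)) ->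
  forall eps, 0 < eps -> exists2 s0, 0 < s0 & forall s, s0 <= s ->
    `|s * F (expR (- s)) - lim (F t @[t --> (0 : R)^'+]) * s| <= eps * s.
Proof.
move=> [a [C [a0 hsup]]] [K K0 hK].
have [L hL] := shifted_fekete a0 (ltW K0) hsup hK.
by rewrite (lim_at0_expR hL).
Qed.

Lemma alpha_min_limit eps : 0 < eps -> exists2 s0, 0 < s0 & forall s, s0 <= s ->
  `|s * inf_ratio G (expR (- s)) - alpha_min G * s| <= eps * s.
Proof.
apply: superadditive_ratio_limit; first exact: inf_ratio_superadditive.
have [B B0 hB] := Sigma_tlen_bound; exists B => // s s0.
by have [] := @ratio_bounds (B * (1 + s)) s s0 (fun p => hB s p s0).
Qed.

Lemma alpha_max_limit eps : 0 < eps -> exists2 s0, 0 < s0 & forall s, s0 <= s ->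
  `|s * sup_ratio G (expR (- s)) - alpha_max G * s| <= eps * s.
Proof.
apply: superadditive_ratio_limit; first exact: sup_ratio_superadditive.
have [B B0 hB] := Sigma_tlen_bound; exists B => // s s0.
by have [] := @ratio_bounds (B * (1 + s)) s s0 (fun p => hB s p s0).
Qed.

End GrowthLimits.

(** * Exponents of arbitrary paths *)

Lemma limn_einf_ge (R : realType) (u : nat -> \bar R) (x : \bar R) N :
  (forall n, (N <= n)%N -> (x <= u n)%E) -> (x <= limn_einf u)%E.
Proof.
move=> xu; rewrite limn_einf_lim; apply: lime_ge; first exact: is_cvg_einfs.
exists N => // n /= Nn; apply: le_ereal_inf_tmp => _ [m /= nm <-].
exact: xu (leq_trans Nn nm).
Qed.

Lemma limn_esup_le (R : realType) (u : nat -> \bar R) (x : \bar R) N :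
  (forall n, (N <= n)%N -> (u n <= x)%E) -> (limn_esup u <= x)%E.
Proof.
move=> xu; rewrite limn_esup_lim; apply: lime_le; first exact: is_cvg_esups.
exists N => // n /= Nn; apply: ge_ereal_sup => _ [m /= nm <-].
exact: xu (leq_trans Nn nm).
Qed.

Section LyapunovBounds.
Variables (R : realType) (G : mps R).

Lemma lyap_ratioE (g : infpath G) n : nonzero (itake g n) ->
  0 < wlen (itake g n) ->
  lyap_ratio g n = (tlen (itake g n) / wlen (itake g n))%:E.
Proof.
move=> gn wn; rewrite /lyap_ratio lne_EFin // inver.
have lnW0 : ln (Wpath (itake g n)) != 0.
  by move: wn; rewrite /wlen oppr_gt0 => /lt_eqF ->.
by rewrite (negbTE lnW0) -EFinM /tlen /wlen invrN mulrNN.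
Qed.

Lemma wlen_itake_ge kappa sigma (g : infpath G) n :
  (forall (u v : G) (e : Defs.arc u v), kappa <= - ln (Warc e) <= sigma) ->
  kappa * n%:R <= wlen (itake g n) <= sigma * n%:R.
Proof.
by move=> arcW; have := wlen_size (itake g n) arcW; rewrite edges_itake size_mkseq.
Qed.

(** Multiplying out the denominators spares the case of the empty initial
    segment, where [wlen] vanishes. *)
Lemma lyap_within (g : infpath G) (l h : R) :
  (forall n, nonzero (itake g n)) ->
  (forall eps, 0 < eps -> exists N, forall n, (N <= n)%N ->
    (l - eps) * wlen (itake g n) <= tlen (itake g n) <= (h + eps) * wlen (itake g n)) ->
  (l%:E <= lower_lyap g)%E /\ (upper_lyap g <= h%:E)%E.
Proof.
move=> g0 glh; have [k [s [k0 _ arcW]]] := arc_wlen_bounds G.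
have wpos n : (0 < n)%N -> 0 < wlen (itake g n).
  move=> n0; have /andP[+ _] := wlen_itake_ge g n arcW; apply: lt_le_trans.
  by rewrite mulr_gt0 // ltr0n.
split.
  apply/lee_addgt0Pr => eps eps0; have [N hN] := glh _ eps0.
  rewrite -leeBlDr // -EFinB; apply: (@limn_einf_ge _ _ _ N.+1) => n Nn.
  have n0 : (0 < n)%N by apply: leq_trans Nn.
  rewrite lyap_ratioE ?wpos // lee_fin ler_pdivlMr ?wpos //.
  by have /andP[] := hN n (ltnW Nn).
apply/lee_addgt0Pr => eps eps0; have [N hN] := glh _ eps0.
rewrite -EFinD; apply: (@limn_esup_le _ _ _ N.+1) => n Nn.
have n0 : (0 < n)%N by apply: leq_trans Nn.
rewrite lyap_ratioE ?wpos // lee_fin ler_pdivrMr ?wpos //.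
by have /andP[] := hN n (ltnW Nn).
Qed.

(** The initial segment with [n.+1] edges belongs to [Sigma_t] for [- ln t] equal to
    the [wlen] of the one with [n] edges; the two lengths differ by one edge. *)
Lemma infpath_ratio_bounds (g : infpath G) : irreducible_mps G ->
  (forall n, nonzero (itake g n)) -> forall eps, 0 < eps ->
  exists N, forall n, (N <= n)%N ->
    (alpha_min G - eps) * wlen (itake g n) <= tlen (itake g n) <=
    (alpha_max G + eps) * wlen (itake g n).
Proof.
move=> irrG g0 eps eps0; have [k [sg [k0 sg0 arcW]]] := arc_wlen_bounds G.
have e2 : 0 < eps / 2 by lra.
have [s1 s10 h1] := alpha_min_limit irrG (ivtx g 0) e2.
have [s2 s20 h2] := alpha_max_limit irrG (ivtx g 0) e2.
have [s3 s30 h3] := eventually_le_linear ((`|alpha_min G| + `|alpha_max G| + eps) * sg) e2.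
pose s0 := s1 + s2 + s3.
exists (Num.truncn (s0 / k)).+2 => -[//|n]; rewrite ltnS => Nn.
set s := wlen (itake g n).
have s0s : s0 <= s.
  have /andP[+ _] := wlen_itake_ge g n arcW; apply: le_trans.
  rewrite mulrC -ler_pdivrMr //; apply: le_trans (ltW (truncnS_gt _)) _.
  by rewrite ler_nat.
have sp : 0 < s by move: s0s; rewrite /s0; lra.
have gS : Sigma_t (expR (- s)) (FinPath (itake g n.+1)).
  apply/SigmaP; split; first exact: (g0 n.+1).
  rewrite wlen_snoc lexx /= ltrDl; have := arcW _ _ (iarc g n); lra.
have := inf_ratio_le irrG (ivtx g 0) sp gS.
have := sup_ratio_ge irrG (ivtx g 0) sp gS.
have := h1 s; have := h2 s; have := h3 s.
move: s0s; rewrite /s0 => s0s.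
move=> /(_ ltac:(lra)) h3s /(_ ltac:(lra)); rewrite ler_norml => /andP[_ h2s].
move=> /(_ ltac:(lra)); rewrite ler_norml => /andP[h1s _].
rewrite [walk _]/= => hi lo.
have -> : wlen (itake g n.+1) = s - ln (Warc (iarc g n)) by rewrite /= wlen_snoc.
set d := - ln _; have /andP[dk dsg] : k <= d <= sg by apply: arcW.
have d0 : 0 <= d by lra.
have hA : (alpha_min G - eps) * d <= `|alpha_min G| * sg.
  apply: (@le_trans _ _ (`|alpha_min G| * d)).
    by rewrite ler_wpM2r //; have := ler_norm (alpha_min G); lra.
  exact: ler_wpM2l.
have hB : - (`|alpha_max G| * sg) <= (alpha_max G + eps) * d.
  rewrite lerNl -mulNr; apply: (@le_trans _ _ (`|alpha_max G| * d)).
    rewrite ler_wpM2r //; have := ler_norm (- alpha_max G); rewrite normrN; lra.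
  exact: ler_wpM2l.
have nA : 0 <= `|alpha_min G| * sg by rewrite mulr_ge0 // ltW.
have nB : 0 <= `|alpha_max G| * sg by rewrite mulr_ge0 // ltW.
have nE : 0 <= eps * sg by rewrite mulr_ge0 // ltW.
by apply/andP; split; lra.
Qed.

End LyapunovBounds.

(** * Paths with a prescribed exponent *)

Lemma quadratic_growth (R : realType) (S : nat -> R) (M eps : R) :
  (forall k, k.+1%:R <= S k.+1 - S k) -> 0 <= S 0%N -> 0 < eps ->
  exists k0, forall k, (k0 <= k)%N -> M * k.+1%:R <= eps * S k.
Proof.
move=> Sinc S0 eps0.
have Sk k : k%:R * k.+1%:R / 2 <= S k.
  elim: k => [|k IH]; first by rewrite !mul0r.
  have := Sinc k; move: IH; rewrite -[k.+2%:R]natr1 -[k.+1%:R]natr1; lra.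
have [s0 _ hs] := eventually_le_linear M (divr_gt0 eps0 (@ltr0n R 2)).
exists (Num.truncn s0).+1 => k kk.
have : M <= eps / 2 * k%:R.
  apply: hs; apply: le_trans (ltW (truncnS_gt _)) _; by rewrite ler_nat.
move=> /(ler_wpM2r (ler0n R k.+1)) /le_trans; apply.
have := ler_wpM2l (ltW eps0) (Sk k); lra.
Qed.

(** A quantity [D] that is pushed back towards zero at every step, up to an
    error that is small relative to the step of the clock [S], remains small
    relative to [S]: it can overshoot zero by at most one step, and one step is
    negligible against the quadratically growing [S]. *)
Lemma restoring_drift (R : realType) (S D : nat -> R) (C : R) :
  (forall k, k.+1%:R <= S k.+1 - S k) -> 0 <= S 0%N ->
  (forall k, `|D k.+1 - D k| <= C * k.+2%:R) ->
  (forall eps, 0 < eps -> exists k0, forall k, (k0 <= k)%N ->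
    (0 < D k -> D k.+1 - D k <= eps * k.+1%:R) /\
    (D k <= 0 -> - (eps * k.+1%:R) <= D k.+1 - D k)) ->
  forall eps, 0 < eps -> exists k0, forall k, (k0 <= k)%N -> `|D k| <= eps * S k.
Proof.
move=> Sinc S0 Djump Drift eps eps0; have e2 : 0 < eps / 2 by lra.
have [k0 hk0] := Drift _ e2.
have C0 : 0 <= C.
  have := Djump 0%N; have := normr_ge0 (D 1%N - D 0%N) => h1 h2.
  by have := le_trans h1 h2; rewrite pmulr_lge0.
(* After k0 steps D stays within its value there, one jump, and the accumulated
   small errors. *)
have claim k : (k0 <= k)%N ->
    `|D k| <= `|D k0| + C * k.+1%:R + eps / 2 * (S k - S k0).
  move=> /subnK <-; elim: (k - k0)%N => [|i IH].
    by rewrite add0n subrr mulr0 addr0 lerDl mulr_ge0.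
  have [Dpos Dneg] := hk0 (i + k0)%N (leq_addl _ _).
  rewrite addSn; move: IH (Djump (i + k0)%N) (Sinc (i + k0)%N) Dpos Dneg.
  set j := (i + k0)%N; rewrite !ler_norml => /andP[l1 l2] /andP[j1 j2] Sj Dpos Dneg.
  have eS : eps / 2 * j.+1%:R <= eps / 2 * (S j.+1 - S j) by rewrite ler_wpM2l // ltW.
  have eS0 : 0 <= eps / 2 * j.+1%:R by rewrite mulr_ge0 // ltW.
  have nD0 := normr_ge0 (D k0).
  have Cj : C * j.+2%:R = C * j.+1%:R + C by rewrite -[j.+2%:R]natr1 mulrDr mulr1.
  have Sk0 : 0 <= eps / 2 * (S j - S k0).
    rewrite mulr_ge0 ?(ltW e2) // subr_ge0 /j; elim: (i) => [|m]; first by rewrite add0n.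
    move/le_trans; apply; rewrite addSn -subr_ge0; apply: le_trans (Sinc _).
    by rewrite ler0n.
  have [Dj|Dj] := ltP 0 (D j).
    by have h := Dpos Dj; apply/andP; split; lra.
  by have h := Dneg Dj; apply/andP; split; lra.
have [k1 hk1] := quadratic_growth (`|D k0| + eps / 2 * `|S k0| + C) Sinc S0 e2.
exists (k0 + k1)%N => k kk; apply: le_trans (claim k _) _.
  exact: leq_trans (leq_addr _ _) kk.
have := hk1 k (leq_trans (leq_addl _ _) kk).
have k1r : 1 <= k.+1%:R :> R by rewrite ler1n.
have : 0 <= `|D k0| * (k.+1%:R - 1) by rewrite mulr_ge0 // subr_ge0.
have : 0 <= eps / 2 * `|S k0| * (k.+1%:R - 1).
  by rewrite !mulr_ge0 // ?subr_ge0 // ltW.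
have : - (eps / 2 * S k0) <= eps / 2 * `|S k0|.
  by rewrite -mulrN ler_wpM2l ?(ltW e2) // -normrN ler_norm.
lra.
Qed.

Section Construction.
Variables (R : realType) (G : mps R) (irrG : irreducible_mps G).
Variables (xi : finpath G) (xi0 : nonzero xi).

(** One step of the construction, on a block of length about [s]. The constant
    [kappa] bounds the number of added edges by their length, which is needed to
    compare the positions of the occurrences of [xi]. *)
Definition block_step (kappa C s : R) (P P' : finpath G) : Prop :=
  [/\ nonzero P', fsrc P' = fsrc P,
      exists t, edges P' = edges P ++ t ++ edges xi,
      (size (edges P) < size (edges P'))%N &
      kappa * ((size (edges P'))%:R - (size (edges P))%:R) <= wlen P' - wlen P /\
      s <= wlen P' - wlen P <= s + C].

(** Splicing bounds [tlen] from above and superadditivity bounds it from below, the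
    two connecting paths and [xi] having bounded length; so [tlen] changes by that of
    the block, up to a constant. *)
Lemma append_block : exists kappa C : R, [/\ 0 < kappa, 0 < C &
  forall (P eta : finpath G) (s : R), nonzero P -> 0 < s ->
    Sigma_t (expR (- s)) eta ->
    exists P' : finpath G, block_step kappa C s P P' /\
      `|tlen P' - tlen P - tlen eta| <= C].
Proof.
have [k [sg [k0 sg0 arcW]]] := arc_wlen_bounds G.
have arcWu (u v : G) (e : Defs.arc u v) : - ln (Warc e) <= sg.
  by have /andP[] := arcW _ _ e.
have [K K0 [_ hK]] := tlen_bound G.
have [k' [M [C0 [k'0 M0 hsplice]]]] := splice irrG.
have KM0 : 0 < K * (1 + M) by rewrite mulr_gt0 // addr_gt0.
have nC0 := normr_ge0 C0; have ntxi := normr_ge0 (tlen xi).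
have wxi := wlen_ge0 xi.
exists k, (2 * `|C0| + `|tlen xi| + 2 * (K * (1 + M)) + sg + 2 * M + wlen xi).
split=> //; first lra.
move=> P eta s P0 s0 etaS.
have [eta0 /andP[el eu]] := Sigma_bounds arcWu etaS.
have [r [P10 P1u /andP[rl ru]]] := hsplice _ _ _ _ _ _ P0 eta0.
have [r' [P'0 P'u /andP[r'l r'u]]] := hsplice _ _ _ _ _ _ P10 xi0.
set P1 := gcat (gcat P r) eta in P10 P1u P'0 P'u.
exists (FinPath (gcat (gcat P1 r') xi)).
have [P1r0 _] := nonzero_gcat P'0; have [_ r'0] := nonzero_gcat P1r0.
have [Pr0 _] := nonzero_gcat P10; have [_ r0] := nonzero_gcat Pr0.
pose B := gcat (gcat (gcat r eta) r') xi.
have PB : gcat (gcat P1 r') xi = gcat P B by rewrite /B !gcatA.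
have wE : wlen (gcat (gcat P1 r') xi) = wlen P + wlen B by rewrite PB wlen_gcat.
have sE : size (edges (gcat (gcat P1 r') xi)) = (size (edges P) + size (edges B))%N.
  by rewrite PB edges_gcat size_cat.
have wB : wlen B = wlen r + wlen eta + wlen r' + wlen xi by rewrite !wlen_gcat.
have /andP[Bl Bu] := wlen_size B arcW.
split; first split=> //=.
- by exists (edges r ++ edges eta ++ edges r'); rewrite !edges_gcat !catA.
- rewrite sE -[X in (X < _)%N]addn0 ltn_add2l -(@ltr0n R).
  by rewrite -(pmulr_rgt0 _ sg0); apply: lt_le_trans Bu; lra.
- rewrite sE natrD wE; split; first by lra.
  by apply/andP; split; lra.
rewrite /=; have := tlen_gcat P'0; have := tlen_gcat P1r0.
have := tlen_gcat P10; have := tlen_gcat Pr0.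
have := hK _ _ _ r0; have := hK _ _ _ r'0.
have : K * (1 + wlen r) <= K * (1 + M) by rewrite ler_wpM2l ?(ltW K0) //; lra.
have : K * (1 + wlen r') <= K * (1 + M) by rewrite ler_wpM2l ?(ltW K0) //; lra.
have := ler_norm C0; have := ler_norm (- tlen xi); rewrite normrN.
have := ler_norm (tlen xi).
rewrite !ler_norml => h1 h2 h3 h4 h5 /andP[h6 _] /andP[h7 _] h8 h9 h10 h11.
by rewrite -/P1 in h9 *; apply/andP; split; lra.
Qed.

(** The choice of block is greedy: [tlen P - a * wlen P] is pushed down by a
    nearly minimal block when it is positive, and up by a nearly maximal one
    otherwise. *)
Lemma greedy_step (a : R) : exists kappa C : R, [/\ 0 < kappa, 0 < C &
  forall (P : finpath G) (s : R), nonzero P -> 0 < s ->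
    exists P' : finpath G, [/\ block_step kappa C s P P',
      `|(tlen P' - a * wlen P') - (tlen P - a * wlen P)| <= C * (1 + s),
      0 < tlen P - a * wlen P ->
        (tlen P' - a * wlen P') - (tlen P - a * wlen P) <=
        s * inf_ratio G (expR (- s)) - a * s + C &
      tlen P - a * wlen P <= 0 ->
        s * sup_ratio G (expR (- s)) - a * s - C <=
        (tlen P' - a * wlen P') - (tlen P - a * wlen P)]].
Proof.
have [kappa [C1 [kappa0 C10 hblock]]] := append_block.
have [B B0 hB] := Sigma_tlen_bound G.
have na := normr_ge0 a.
have aC1 : 0 <= `|a| * C1 by rewrite mulr_ge0 // ltW.
pose C := C1 + `|a| * C1 + 1 + B + `|a|.
have C0 : 0 < C by rewrite /C; lra.
exists kappa, C; split=> // P s P0 s0.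
have hs0 := ltW s0.
have block (eta : finpath G) : Sigma_t (expR (- s)) eta ->
    exists P' : finpath G, [/\ block_step kappa C s P P',
      `|(tlen P' - a * wlen P') - (tlen P - a * wlen P)| <= C * (1 + s) &
      `|(tlen P' - a * wlen P') - (tlen P - a * wlen P) - (tlen eta - a * s)|
         <= C1 + `|a| * C1].
  move=> etaS; have [P' [[P'0 P's P't P'z [P'k /andP[wl wu]]] tP']] := hblock _ _ _ P0 s0 etaS.
  have hd : `|a * (wlen P' - wlen P - s)| <= `|a| * C1.
    by rewrite normrM ler_wpM2l // ger0_norm; lra.
  have has : `|a * s| <= `|a| * s by rewrite normrM (gtr0_norm s0).
  have heta := hB _ _ s0 etaS.
  move: hd tP' has heta; rewrite !ler_norml.
  move=> /andP[d1 d2] /andP[t1 t2] /andP[a1 a2] /andP[e1 e2].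
  exists P'; split; last by rewrite ler_norml; apply/andP; split; lra.
    by split=> //; split=> //; apply/andP; split; rewrite /C; lra.
  have CE : C * (1 + s) = C + C1 * s + `|a| * C1 * s + s + B * s + `|a| * s.
    by rewrite /C; ring.
  have : 0 <= C1 * s by rewrite mulr_ge0 // ltW.
  have : 0 <= `|a| * C1 * s by rewrite mulr_ge0.
  have : 0 <= B * s by rewrite mulr_ge0 // ltW.
  by rewrite CE /C ler_norml => h1 h2 h3; apply/andP; split; lra.
have [D0|D0] := ltP 0 (tlen P - a * wlen P).
  have [eta etaS eta_small] := near_inf_ratio irrG (fsrc xi) s0.
  have [P' [h1 h2]] := block _ etaS; rewrite ler_norml => /andP[_ h3].
  exists P'; split=> // _.
  by rewrite /C; lra.
have [eta etaS eta_big] := near_sup_ratio irrG (fsrc xi) s0.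
have [P' [h1 h2]] := block _ etaS; rewrite ler_norml => /andP[h3 _].
exists P'; split=> // _.
by rewrite /C; lra.
Qed.

(** The minimum of [tlen] over blocks of length [s] is about [alpha_min G * s], at
    most [a * s] up to [o(s)], and dually for the maximum: this makes the greedy
    steps a restoring drift. *)
Lemma greedy_sequence (a : R) : alpha_min G <= a <= alpha_max G ->
  exists (kappa C : R) (P : nat -> finpath G), [/\ 0 < kappa, 0 < C,
    nonzero (P 0%N),
    forall k, block_step kappa C k.+1%:R (P k) (P k.+1) &
    (forall k, `|(tlen (P k.+1) - a * wlen (P k.+1)) -
                 (tlen (P k) - a * wlen (P k))| <= C * k.+2%:R) /\
    forall eps, 0 < eps -> exists k0, forall k, (k0 <= k)%N ->
      `|tlen (P k) - a * wlen (P k)| <= eps * wlen (P k)].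
Proof.
move=> /andP[amin amax]; have [kappa [C [kappa0 C0 step]]] := greedy_step a.
pose T := {P : finpath G | nonzero P}.
have /choice[f hf] (kP : nat * T) := step (sval kP.2) kP.1.+1%:R (svalP kP.2)
  (@ltr0Sn R kP.1).
have f0 kP : nonzero (f kP) by have [[]] := hf kP.
pose Q := fix Q n : T := if n is k.+1 then exist _ (f (k, Q k)) (f0 _)
  else exist _ (FinPath (@pnil G (fsrc xi))) (@nonzero_nil R G (fsrc xi)).
pose P k := sval (Q k).
have hP k := hf (k, Q k); rewrite /= in hP.
have hstep k : block_step kappa C k.+1%:R (P k) (P k.+1) by have [] := hP k.
have Sinc k : k.+1%:R <= wlen (P k.+1) - wlen (P k).
  by have [_ _ _ _ [_ /andP[]]] := hstep k.
have hjump k : `|(tlen (P k.+1) - a * wlen (P k.+1)) -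
                 (tlen (P k) - a * wlen (P k))| <= C * k.+2%:R.
  by have [_ + _ _] := hP k; rewrite -[k.+2%:R]natr1 [_ + 1]addrC.
exists kappa, C, P; split=> //; first exact: (svalP (Q 0%N)).
split=> //; apply: (restoring_drift Sinc (wlen_ge0 _) hjump) => eps eps0.
have e2 : 0 < eps / 2 by lra.
have [s1 _ h1] := alpha_min_limit irrG (fsrc xi) e2.
have [s2 _ h2] := alpha_max_limit irrG (fsrc xi) e2.
have [s3 _ h3] := eventually_le_linear C e2.
exists (Num.truncn (`|s1| + `|s2| + `|s3|)).+1 => k kk.
have ks : `|s1| + `|s2| + `|s3| <= k.+1%:R.
  apply: le_trans (ltW (truncnS_gt _)) _; rewrite ler_nat.
  exact: leq_trans kk _.
have n1 := ler_norm s1; have n2 := ler_norm s2; have n3 := ler_norm s3.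
have p1 := normr_ge0 s1; have p2 := normr_ge0 s2; have p3 := normr_ge0 s3.
have := h1 k.+1%:R ltac:(lra); rewrite ler_norml => /andP[_ hmin].
have := h2 k.+1%:R ltac:(lra); rewrite ler_norml => /andP[hmax _].
have hC := h3 k.+1%:R ltac:(lra).
have k0 : 0 <= k.+1%:R :> R by rewrite ler0n.
have hamin := ler_wpM2r k0 amin; have hamax := ler_wpM2r k0 amax.
have [_ _ Dpos Dneg] := hP k; rewrite -/(P k) -[f _]/(P k.+1) in Dpos Dneg *.
by split=> [/Dpos|/Dneg]; lra.
Qed.

End Construction.

Lemma bracket (z : nat -> nat) k0 n : (forall k, (z k < z k.+1)%N) ->
  (z k0 <= n)%N -> exists2 k, (k0 <= k)%N & (z k <= n < z k.+1)%N.
Proof.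
move=> zinc; elim: n => [|n IH].
  rewrite leqn0 => /eqP z0; exists k0 => //; rewrite z0 /=.
  exact: leq_ltn_trans (zinc k0).
rewrite leq_eqVlt => /predU1P[zn|]; first by exists k0; rewrite // -zn leqnn zinc.
rewrite ltnS => /IH[k kk /andP[zl zu]].
have [zk|zk] := ltnP n.+1 (z k.+1); first by exists k => //; rewrite zk andbT ltnW.
exists k.+1; first exact: leqW.
by rewrite zk /=; apply: leq_ltn_trans zu (zinc _).
Qed.

Lemma is_prefix_suffix (G : digraph) (xi P : finpath G) (g : infpath G) s :
  edges P = s ++ edges xi -> FinPath (itake g (size (edges P))) = P ->
  is_prefix xi (ishift (size s) g).
Proof.
move=> PE gP; exists (ishift (size (edges xi) + size s) g) => k.
have gE (h : infpath G) m i : iedge (ishift m h) i = iedge h (i + m)%N by [].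
rewrite !gE; have [kx|xk] := ltnP k (size (edges xi)); last first.
  by rewrite nth_default // addnA subnK.
have : nth (iedge g 0) (edges P) (k + size s)%N = iedge g (k + size s)%N.
  have -> : edges P = mkseq (iedge g) (size (edges P)).
    by rewrite -edges_itake; apply: esym (congr1 (fun p : finpath G => edges p) gP).
  rewrite nth_mkseq //.
  by rewrite PE size_cat addnC ltn_add2l.
rewrite PE nth_cat ltnNge leq_addl /= addnK => <-.
exact: set_nth_default.
Qed.

Section GreedyPath.
Variables (R : realType) (G : mps R).

(** Between two consecutive block ends the norm moves by a factor that is at most
    exponential in the length of the block, and blocks are short compared with
    what precedes them; so the quotient at block ends decides the exponent. *)
Lemma exponent_from_blocks (g : infpath G) (a : R) (z : nat -> nat) (C : R) :
  (forall k, (z k < z k.+1)%N) ->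
  (forall k, nonzero (itake g (z k))) ->
  (forall k, k.+1%:R <= wlen (itake g (z k.+1)) - wlen (itake g (z k))
     <= k.+1%:R + C) ->
  (forall k, `|(tlen (itake g (z k.+1)) - a * wlen (itake g (z k.+1))) -
               (tlen (itake g (z k)) - a * wlen (itake g (z k)))|
     <= C * k.+2%:R) ->
  (forall eps, 0 < eps -> exists k0, forall k, (k0 <= k)%N ->
    `|tlen (itake g (z k)) - a * wlen (itake g (z k))| <=
      eps * wlen (itake g (z k))) ->
  has_lyap g a%:E.
Proof.
move=> zinc gz0 Sinc Djump Dlim.
have [K K0 [_ hK]] := tlen_bound G.
have C0 : 0 <= C.
  have h1 := normr_ge0 ((tlen (itake g (z 1%N)) - a * wlen (itake g (z 1%N))) -
               (tlen (itake g (z 0%N)) - a * wlen (itake g (z 0%N)))).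
  by have := le_trans h1 (Djump 0%N); rewrite pmulr_lge0.
have zk k : (k <= z k)%N.
  by elim: k => // k IH; apply: leq_ltn_trans IH (zinc k).
have g0 n : nonzero (itake g n).
  have [q qE] := itake_split g (zk n).
  by have := gz0 n; rewrite qE => /nonzero_gcat[].
suff close eps : 0 < eps -> exists N, forall n, (N <= n)%N ->
    (a - eps) * wlen (itake g n) <= tlen (itake g n) <=
    (a + eps) * wlen (itake g n).
  have [lo hi] := lyap_within g0 close.
  have mid : (lower_lyap g <= upper_lyap g)%E by apply: limn_einf_sup.
  split; apply/eqP; rewrite eq_le; apply/andP; split=> //.
  - exact: le_trans mid hi.
  - exact: le_trans lo mid.
move=> eps0; have e2 : 0 < eps / 2 by lra.
(* Twice A bounds, per unit of k.+1, the effect of a jump and of an incomplete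
   block on either side. *)
pose A := (`|a| + K) * (1 + C) + K + C.
have Sinc1 k : k.+1%:R <= wlen (itake g (z k.+1)) - wlen (itake g (z k)).
  by have /andP[] := Sinc k.
have [k0 hk0] := Dlim _ e2.
have [k1 hk1] := quadratic_growth (2 * A) Sinc1 (wlen_ge0 _) e2.
exists (z (k0 + k1)%N) => n zn.
have [k kk /andP[zl zu]] := bracket zinc zn.
have [q qE] := itake_split g zl; have [q' q'E] := itake_split g (ltnW zu).
have hD := hk0 k (leq_trans (leq_addr _ _) kk).
have hQ := hk1 k (leq_trans (leq_addl _ _) kk).
have := Djump k; have /andP[_] := Sinc k.
have qn : nonzero q by have := g0 n; rewrite qE => /nonzero_gcat[].
have q'n : nonzero q' by have := g0 (z k.+1); rewrite q'E => /nonzero_gcat[].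
have tq : tlen (itake g (z k)) + tlen q <= tlen (itake g n).
  by rewrite qE; apply: tlen_gcat; rewrite -qE.
have tq' : tlen (itake g n) + tlen q' <= tlen (itake g (z k.+1)).
  by rewrite q'E; apply: tlen_gcat; rewrite -q'E.
have wq : wlen (itake g n) = wlen (itake g (z k)) + wlen q by rewrite qE wlen_gcat.
have wq' : wlen (itake g (z k.+1)) = wlen (itake g n) + wlen q'.
  by rewrite q'E wlen_gcat.
have := hK _ _ _ qn; have := hK _ _ _ q'n.
have := wlen_ge0 q; have := wlen_ge0 q'; have := wlen_ge0 (itake g (z k)).
move: hD hQ tq tq'; rewrite wq' wq.
move: (tlen (itake g n)) (tlen (itake g (z k))) (tlen (itake g (z k.+1))) => tn tk tk1.
move: (wlen (itake g (z k))) (tlen q) (tlen q') (wlen q) (wlen q') => wk tlq tlq' x y.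
rewrite !ler_norml => /andP[D1 D2] hQ tq tq' w0 y0 x0 /andP[l1 _] /andP[l2 _] hxy.
move=> /andP[_ j2].
have k1r : 1 <= k.+1%:R :> R by rewrite ler1n.
have kC : 0 <= C * (k.+1%:R - 1) by rewrite mulr_ge0 // subr_ge0.
have xb : x <= k.+1%:R + C by lra.
have yb : y <= k.+1%:R + C by lra.
have bound_a t : 0 <= t -> t <= k.+1%:R + C ->
    `|a * t| <= `|a| * ((1 + C) * k.+1%:R) /\ K * t <= K * ((1 + C) * k.+1%:R).
  move=> t0 tb; have tb2 : t <= (1 + C) * k.+1%:R by lra.
  split; last by rewrite ler_wpM2l // ltW.
  by rewrite normrM ler_wpM2l // ger0_norm.
have [ax Kx] := bound_a _ x0 xb; have [ay Ky] := bound_a _ y0 yb.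
move: ax ay; rewrite !ler_norml => /andP[ax1 ax2] /andP[ay1 ay2].
have ek : 0 <= eps / 2 * wk by rewrite mulr_ge0 // ltW.
have ex : 0 <= eps * x by rewrite mulr_ge0 // ltW.
have Ck : C * k.+2%:R = C * k.+1%:R + C by rewrite -[k.+2%:R]natr1 mulrDr mulr1.
have hA : 2 * A * k.+1%:R = 2 * (`|a| * ((1 + C) * k.+1%:R)) +
    2 * (K * ((1 + C) * k.+1%:R)) + 2 * (K * k.+1%:R) + 2 * (C * k.+1%:R).
  by rewrite /A; ring.
have Kk : 0 <= K * (k.+1%:R - 1) by rewrite mulr_ge0 ?subr_ge0 // ltW.
have pa : 0 <= `|a| * ((1 + C) * k.+1%:R).
  by apply: mulr_ge0 => //; apply: mulr_ge0; lra.
have pK : 0 <= K * ((1 + C) * k.+1%:R).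
  by apply: mulr_ge0; [exact: ltW|apply: mulr_ge0; lra].
rewrite hA in hQ; by apply/andP; split; lra.
Qed.

End GreedyPath.

Theorem theorem2p10 (R : realType) (G : mps R) (irrG : irreducible_mps G) :
  (forall g : infpath G,
     (forall n : nat, 0 < mxsum (Tpath (itake g n))) ->
     ((alpha_min G)%:E <= lower_lyap g <= (alpha_max G)%:E)%E /\
     ((alpha_min G)%:E <= upper_lyap g <= (alpha_max G)%:E)%E) /\
  (forall (a : R) (xi : finpath G),
     alpha_min G <= a <= alpha_max G ->
     Tpath xi <> 0 ->
     exists (g : infpath G) (m : nat -> nat),
       [/\ has_lyap g a%:E,
           (forall j : nat, (0 < m j)%N),
           (m j.+1)%:R / (m j)%:R @[j --> \oo] --> (1 : R) &
           forall j : nat, is_prefix xi (ishift (m j).-1 g)]).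
Proof.
split=> [g g0|a xi aI xi_neq0].
  have [lo hi] := lyap_within g0 (infpath_ratio_bounds irrG g0).
  have mid : (lower_lyap g <= upper_lyap g)%E by apply: limn_einf_sup.
  rewrite lo hi !andbT; split; first exact: le_trans mid hi.
  exact: le_trans lo mid.
have xi0 : nonzero xi.
  rewrite /nonzero lt_neqAle mxsum_ge0 ?andbT; last exact: Tpath_ge0.
  apply/eqP => xi_sum0; apply: xi_neq0; apply/matrixP => i j; rewrite mxE.
  apply/eqP; rewrite eq_le Tpath_ge0 andbT xi_sum0.
  exact: mxsum_ge_entry (@Tpath_ge0 _ _ _ _ xi).
have [kappa [C [P [kappa0 C0 P00 Pstep [Pjump Plim]]]]] := greedy_sequence irrG xi0 aI.
pose z k := size (edges (P k)).
have zinc k : (z k < z k.+1)%N by have [] := Pstep k.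
have Pnz k : nonzero (P k) by case: k => // k; have [] := Pstep k.
have [||k|g gP] := @chain_limit G P.
- have Psrc k : fsrc (P k.+1) = fsrc (P k) by have [] := Pstep k.
  by elim=> // k <-.
- by move=> k; have [_ _ [t ->] _ _] := Pstep k; exists (t ++ edges xi).
- by elim: k => // k IH; apply: leq_ltn_trans IH (zinc k).
have wE k : wlen (itake g (z k)) = wlen (P k).
  exact: (congr1 (fun p : finpath G => wlen p) (gP k)).
have tE k : tlen (itake g (z k)) = tlen (P k).
  exact: (congr1 (fun p : finpath G => tlen p) (gP k)).
have Sinc k : k.+1%:R <= wlen (P k.+1) - wlen (P k) <= k.+1%:R + C.
  by have [_ _ _ _ []] := Pstep k.
have suffix j : edges (P j.+1) =
    take (z j.+1 - size (edges xi))%N (edges (P j.+1)) ++ edges xi /\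
    (z j + size (edges xi) <= z j.+1)%N.
  rewrite /z; have [_ _ [t ->] _ _] := Pstep j.
  rewrite catA !size_cat addnK take_size_cat ?size_cat //.
  by rewrite addnAC leq_addr.
(* P j.+1 ends with a copy of xi; positions are counted from 1. *)
exists g, (fun j => (z j.+1 - size (edges xi)).+1); split=> //.
- apply: (@exponent_from_blocks _ _ _ _ z C) => //.
  + move=> k; rewrite /nonzero.
    by rewrite (congr1 (fun p : finpath G => mxsum (Tpath p)) (gP k)); apply: Pnz.
  + by move=> k; rewrite !wE.
  + by move=> k; rewrite !wE !tE.
  + by move=> eps /Plim[k0 hk0]; exists k0 => k /hk0; rewrite !wE !tE.
(* Two consecutive occurrences lie within two consecutive blocks, of total length
   O(j), whereas the position of the first is of order j ^ 2. *)
- have [k [sg [k0 sg0 arcW]]] := arc_wlen_bounds G.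
  apply/cvgrPdist_le => eps eps0.
  have e0 : 0 < eps * kappa / sg by rewrite divr_gt0 // mulr_gt0.
  have Sinc1 i : i.+1%:R <= wlen (P i.+1) - wlen (P i) by have /andP[] := Sinc i.
  have [j0 hj0] := quadratic_growth (3 + 2 * C) Sinc1 (wlen_ge0 _) e0.
  exists j0 => // j /= jj.
  have [_ zj] := suffix j; have [_ zj1] := suffix j.+1.
  set mj := (z j.+1 - _).+1; set mj1 := (z j.+2 - _).+1.
  have mj0 : 0 < mj%:R :> R by rewrite ltr0n.
  have mz : (z j < mj)%N by rewrite /mj; move: zj; lia.
  have mm : (mj <= mj1)%N by rewrite ltnS leq_sub2r // ltnW.
  have mdiff : mj1%:R - mj%:R <= (z j.+2)%:R - (z j)%:R :> R.
    rewrite -natrB // -natrB ?ler_nat; last by rewrite ltnW // (ltn_trans (zinc j)).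
    by rewrite /mj1 /mj; move: zj zj1 (zinc j) (zinc j.+1); lia.
  have [_ _ _ _ [kz1 /andP[_ wz1]]] := Pstep j.
  have [_ _ _ _ [kz2 /andP[_ wz2]]] := Pstep j.+1.
  have /andP[_ wzj] := wlen_size (P j) arcW.
  have hq := hj0 _ jj.
  have -> : 1 - mj1%:R / mj%:R = (mj%:R - mj1%:R) / mj%:R :> R.
    by rewrite mulrBl divff // gt_eqF.
  rewrite normrM distrC.
  rewrite [`|mj%:R^-1|]ger0_norm ?invr_ge0 // ler_pdivrMr //.
  rewrite ger0_norm ?subr_ge0 ?ler_nat // -(ler_pM2l kappa0).
  apply: (@le_trans _ _ ((3 + 2 * C) * j.+1%:R)).
    apply: (@le_trans _ _ (kappa * ((z j.+2)%:R - (z j)%:R))).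
      by rewrite ler_wpM2l // ltW.
    have j1r : 1 <= j.+1%:R :> R by rewrite ler1n.
    have : 0 <= C * (j.+1%:R - 1) by rewrite mulr_ge0 ?subr_ge0 // ltW.
    rewrite -[j.+2%:R]natr1 in wz2; move: kz1 kz2; rewrite -/(z _) -/(z _); lra.
  have wm : wlen (P j) / sg <= mj%:R.
    rewrite ler_pdivrMr // mulrC; apply: le_trans wzj _.
    by rewrite ler_pM2l // ler_nat ltnW.
  apply: le_trans hq _; rewrite mulrAC -mulrA [leRHS]mulrA [kappa * eps]mulrC.
  by rewrite ler_pM2l // mulr_gt0.
- move=> j; have [sE _] := suffix j.
  have := is_prefix_suffix sE (gP j.+1); rewrite size_take /=.
  case: ltnP => // h; have := zinc j.
  by rewrite -/(z j.+1) (_ : z j.+1 - _ = z j.+1)%N //; apply/eqP; rewrite eqn_leq leq_subr.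
Qed.
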